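(* There is an absolute constant $C$ such that the following holds. Let $\mathcal{P}$ be a set of $n$ points in the dual plane $\mathbb{D}^2$ with multiplicity $n^{\lambda}$, for some $0\le\lambda\le 1$. Then the number of unit distances spanned by $\mathcal{P}$, that is, the number of pairs of points $p,q\in\mathcal{P}$ with $\rho_{\mathbb{D}^2}(p,q)=1=[1,0]$, is at most \[ C\left(n^{1+\lambda}\log^4 n+n^{4/3}\log^2 n\right). \]
   Context: The dual numbers $\mathbb{D}$ are the two-dimensional unital associative $\mathbb{R}$-algebra obtained by adjoining to $\mathbb{R}$ an element $\varepsilon$ with $\varepsilon^2=0$. Each dual number is uniquely $x+y\varepsilon$ with $x,y\in\mathbb{R}$, and is denoted $[x,y]$. A point $(x+y\varepsilon,z+w\varepsilon)\in\mathbb{D}^2$ is denoted $[x,y,z,w]$; its real part is $(x,z)\in\mathbb{R}^2$ and its imaginary part is $(y,w)\in\mathbb{R}^2$. The distance function $\rho_{\mathbb{D}^2}:\mathbb{D}^2\times\mathbb{D}^2\to\mathbb{D}$ is \[\rho_{\mathbb{D}^2}([x,y,z,w],[x',y',z',w'])=\big((x+y\varepsilon)-(x'+y'\varepsilon)\big)^2+\big((z+w\varepsilon)-(z'+w'\varepsilon)\big)^2,\] which equals $[(x-x')^2+(z-z')^2,\ 2((x-x')(y-y')+(z-z')(w-w'))]$. The multiplicity of a finite nonempty set $\mathcal{P}\subset\mathbb{D}^2$ is the largest integer $k$ such that there exist $k$ points of $\mathcal{P}$ with the same real part. *)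

(* Defs.v *)
From HB Require Import structures.
From mathcomp Require Import all_boot all_order all_algebra.
From mathcomp Require Import finmap.
From mathcomp Require Import ring.

Set Implicit Arguments.
Unset Strict Implicit.
Unset Printing Implicit Defensive.

Import Order.TTheory GRing.Theory Num.Theory.

Local Open Scope fset_scope.
Local Open Scope ring_scope.

(* A record rather than an alias of [R * R], whose canonical ring structure is
   the componentwise one. *)
Record dualnum (R : Type) : Type := Dual { dual_re : R; dual_im : R }.

Section DualNumberRing.
Variable R : comNzRingType.
Implicit Types u v w : dualnum R.

Let pair_of_dual u : R * R := (dual_re u, dual_im u).
Let dual_of_pair (p : R * R) : dualnum R := Dual p.1 p.2.

Fact pair_of_dualK : cancel pair_of_dual dual_of_pair.
Proof. by case. Qed.

HB.instance Definition _ := Choice.copy (dualnum R) (can_type pair_of_dualK).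

Definition dual_zero : dualnum R := Dual 0 0.
Definition dual_one : dualnum R := Dual 1 0.
Definition dual_opp u := Dual (- dual_re u) (- dual_im u).
Definition dual_add u v := Dual (dual_re u + dual_re v) (dual_im u + dual_im v).
Definition dual_mul u v :=
  Dual (dual_re u * dual_re v) (dual_re u * dual_im v + dual_im u * dual_re v).
Definition dual_scale (a : R) u := Dual (a * dual_re u) (a * dual_im u).

Fact dual_addA : associative dual_add.
Proof. by move=> [a b] [c d] [e f]; congr Dual; rewrite /= addrA. Qed.
Fact dual_addC : commutative dual_add.
Proof. by move=> [a b] [c d]; congr Dual; rewrite /= addrC. Qed.
Fact dual_add0 : left_id dual_zero dual_add.
Proof. by move=> [a b]; congr Dual; rewrite /= add0r. Qed.
Fact dual_addN : left_inverse dual_zero dual_opp dual_add.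
Proof. by move=> [a b]; congr Dual; rewrite /= addNr. Qed.

HB.instance Definition _ := GRing.isZmodule.Build (dualnum R)
  dual_addA dual_addC dual_add0 dual_addN.

Fact dual_mulA : associative dual_mul.
Proof. by move=> [a b] [c d] [e f]; congr Dual => /=; ring. Qed.
Fact dual_mulC : commutative dual_mul.
Proof. by move=> [a b] [c d]; congr Dual => /=; ring. Qed.
Fact dual_mul1 : left_id dual_one dual_mul.
Proof. by move=> [a b]; congr Dual => /=; ring. Qed.
Fact dual_mulDl : left_distributive dual_mul dual_add.
Proof. by move=> [a b] [c d] [e f]; congr Dual => /=; ring. Qed.
Fact dual_1neq0 : dual_one != dual_zero.
Proof. by apply/eqP => -[/eqP]; rewrite oner_eq0. Qed.

HB.instance Definition _ := GRing.Zmodule_isComNzRing.Build (dualnum R)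
  dual_mulA dual_mulC dual_mul1 dual_mulDl dual_1neq0.

Fact dual_scaleA a b u : dual_scale a (dual_scale b u) = dual_scale (a * b) u.
Proof. by case: u => c d; congr Dual => /=; ring. Qed.
Fact dual_scale1 : left_id 1 dual_scale.
Proof. by move=> [a b]; congr Dual => /=; ring. Qed.
Fact dual_scaleDr : right_distributive dual_scale +%R.
Proof. by move=> a [c d] [e f]; congr Dual => /=; ring. Qed.
Fact dual_scaleDl u : {morph dual_scale^~ u : a b / a + b}.
Proof. by move=> a b; case: u => c d; congr Dual => /=; ring. Qed.

HB.instance Definition _ := GRing.Zmodule_isLmodule.Build R (dualnum R)
  dual_scaleA dual_scale1 dual_scaleDr dual_scaleDl.

Fact dual_scaleAl (a : R) u v : a *: (u * v) = (a *: u) * v.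
Proof. by case: u v => [c d] [e f]; congr Dual => /=; ring. Qed.

HB.instance Definition _ :=
  GRing.Lmodule_isLalgebra.Build R (dualnum R) dual_scaleAl.

Fact dual_scaleAr (a : R) u v : a *: (u * v) = u * (a *: v).
Proof. by case: u v => [c d] [e f]; congr Dual => /=; ring. Qed.

HB.instance Definition _ :=
  GRing.Lalgebra_isAlgebra.Build R (dualnum R) dual_scaleAr.

Definition dual_eps : dualnum R := Dual 0 1.

Lemma dual_eps_sqr : dual_eps ^+ 2 = 0.
Proof. by rewrite expr2; congr Dual => /=; ring. Qed.

Lemma dualE (x y : R) : Dual x y = x%:A + y *: dual_eps.
Proof. by congr Dual => /=; ring. Qed.

End DualNumberRing.

Notation dual_plane R := (dualnum R * dualnum R)%type.

Section DualPlane.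
Variable R : comNzRingType.

Definition real_part (p : dual_plane R) : R * R := (dual_re p.1, dual_re p.2).

Definition rho (p q : dual_plane R) : dualnum R :=
  (p.1 - q.1) ^+ 2 + (p.2 - q.2) ^+ 2.

Lemma rhoE (x y z w x' y' z' w' : R) :
  rho (Dual x y, Dual z w) (Dual x' y', Dual z' w') =
  Dual ((x - x') ^+ 2 + (z - z') ^+ 2)
       (2 * ((x - x') * (y - y') + (z - z') * (w - w'))).
Proof. by rewrite /rho !expr2; congr Dual => /=; ring. Qed.

Definition same_real_part (Q : {fset dual_plane R}) : bool :=
  [forall p : Q, forall q : Q, real_part (val p) == real_part (val q)].

Definition multiplicity (P : {fset dual_plane R}) : nat :=
  \max_(Q <- fpowerset P | same_real_part Q) #|` Q|.

(* Ordered pairs: each unit distance is counted twice. *)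
Definition unit_distances (P : {fset dual_plane R}) : nat :=
  #|` [fset pq in P `*` P | rho pq.1 pq.2 == 1]|.

End DualPlane.

(* Main.v *)
Require Import Defs.
From mathcomp Require Import all_boot all_order all_algebra.
From mathcomp Require Import finmap.
From mathcomp Require Import all_classical all_reals all_analysis.
From mathcomp Require Import ring lra.

(* Group the points of P by their real parts: m_a points lie over a. Over a
   pair a, b of real parts at unit distance, the unit distances pair up the
   points whose imaginary parts have the same projection on a - b. Two distinct
   points over a have equal projections for at most two vectors a - b, so by
   AM-GM with weights the count is at most the sum of sqrt (m_a m_b) over the
   unit pairs (a, b), plus 2 M n, where M is the multiplicity. Cutting the real
   parts into the layers {m_a >= 2^k}, of size at most n / 2^k, reduces that sum
   to the Szemeredi-Trotter bound for unit distances in the real plane, with a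
   geometric gain in k.

   For the latter, four quarter circles are extended to strictly concave graphs,
   whose translates are pseudolines. A greedily chosen sample S of r log n of
   them meets every trapezoidal cell that is met by more than n / r pseudolines;
   S cuts the plane into at most 2 |S|^2 cells, and the Kovari-Sos-Turan bound is
   applied in each of them. *)

Import Order.TTheory GRing.Theory Num.Theory.
Local Open Scope ring_scope.

Set Implicit Arguments.
Unset Strict Implicit.
Unset Printing Implicit Defensive.

(** * Greedy hitting sets *)

Section HittingSet.
Variables (R : realType) (C D : finType) (X : D -> {set C}) (r : R).
Hypothesis r_ge1 : 1 <= r.
Hypothesis X_large : forall d, #|C|%:R <= r * #|X d|%:R.

Let missed (S : {set C}) : {set D} := [set d | [disjoint X d & S]].

(** Double counting: each missed set has at least [|C| / r] elements, so on average an element of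
    [C] lies in a fraction [1 / r] of the missed sets, and some element reaches the average. *)
Lemma greedy_step (S : {set C}) : (0 < #|C|)%N ->
  exists c, #|missed (c |: S)|%:R <= #|missed S|%:R * (1 - r^-1).
Proof.
move=> C0.
have r0 : 0 < r by apply: lt_le_trans r_ge1.
pose h c := #|[set d in missed S | c \in X d]|.
have [c hc] : exists c, #|missed S|%:R * r^-1 <= (h c)%:R.
  apply: contrapT => /forallNP hN.
  have lt_h c : (h c)%:R < #|missed S|%:R * r^-1 by rewrite ltNge; apply/negP.
  have sumE : (\sum_c h c = \sum_(d in missed S) #|X d|)%N.
    rewrite /h; under eq_bigr do rewrite -sum1dep_card.
    rewrite (exchange_big_dep (mem (missed S))) /=; last by move=> c d _ /andP[].
    apply: eq_bigr => d dS; rewrite -sum1_card; apply: eq_bigl => c.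
    by rewrite dS.
  have : \sum_(c : C) (h c)%:R < \sum_(c : C) #|missed S|%:R * r^-1.
    have [c0 _] := card_gt0P C0.
    apply: ltr_sum => [|c _]; last exact: lt_h.
    by apply/hasP; exists c0; rewrite ?mem_index_enum.
  rewrite -natr_sum sumE sumr_const natr_sum ltNge => /negP; apply.
  rewrite -mulrnAr mulr_natl -sumr_const; apply: ler_sum => d _.
  by rewrite -mulr_natr mulrC ler_pdivrMr// mulrC.
exists c.
have -> : missed (c |: S) = missed S :\: [set d in missed S | c \in X d].
  apply/setP => d; rewrite !inE disjoint_sym (_ : [disjoint c |: S & X d] =
    (c \notin X d) && [disjoint X d & S]); last first.
    rewrite [in RHS]disjoint_sym -disjointU1; apply: eq_disjoint => z.
    by rewrite !inE.
  by case: (c \in X d); case: [disjoint X d & S].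
rewrite cardsD (finset.setIidPr _); last by apply/fintype.subsetP => d; rewrite !inE => /andP[].
rewrite natrB; last by apply/subset_leq_card/fintype.subsetP => d; rewrite !inE => /andP[].
by rewrite mulrBr mulr1 lerD2l lerN2.
Qed.

Lemma greedy_iter k : (0 < #|C|)%N ->
  exists2 S : {set C}, (#|S| <= k)%N & #|missed S|%:R <= #|D|%:R * (1 - r^-1) ^+ k.
Proof.
move=> C0; elim: k => [|k [S Sk hS]].
  by exists finset.set0; rewrite ?cards0// expr0 mulr1 ler_nat max_card.
have [c hc] := greedy_step S C0; exists (c |: S).
  by rewrite cardsU1 (leq_add (leq_b1 _)).
apply: (le_trans hc); rewrite exprSr mulrA ler_wpM2r// subr_ge0 invf_le1//.
exact: lt_le_trans r_ge1.
Qed.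

(** After [k > r ln |D|] greedy steps at most [|D| (1 - 1/r)^k <= |D| exp (- k / r) < 1] sets are
    missed, hence none. *)
Lemma hitting_set : (0 < #|C|)%N -> (0 < #|D|)%N ->
  exists2 S : {set C}, #|S|%:R <= r * ln #|D|%:R + 1 &
    forall d, ~~ [disjoint X d & S].
Proof.
move=> C0 D0.
have r0 : 0 < r by apply: lt_le_trans r_ge1.
have x0 : 0 <= r * ln #|D|%:R :> R.
  by rewrite mulr_ge0 ?(ltW r0)// ln_ge0// ler1n.
pose k := (Num.truncn (r * ln #|D|%:R : R)).+1.
have [S Sk hS] := greedy_iter k C0; exists S.
  rewrite (le_trans (_ : _ <= k%:R)) ?ler_nat// /k -natr1 lerD2r.
  by rewrite truncn_le.
move=> d; apply/negP => dS.
have k1 : (0 < #|missed S|)%N by apply/card_gt0P; exists d; rewrite inE.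
suff : #|missed S|%:R < 1 :> R by rewrite ltrn1 ltnNge k1.
apply: (le_lt_trans hS).
have : (1 - r^-1) ^+ k <= expR (- r^-1) ^+ k.
  rewrite lerXn2r// ?nnegrE ?expR_ge0 ?expR_ge1Dx//.
  by rewrite subr_ge0 invf_le1.
rewrite -expRM_natl => hk.
apply: (@le_lt_trans _ _ (#|D|%:R * expR (k%:R * - r^-1))).
  by rewrite ler_wpM2l.
rewrite -[X in X * _](@lnK R) ?posrE ?ltr0n// -expRD -[ltRHS]expR0 ltr_expR.
rewrite mulrN subr_lt0 ltr_pdivlMr// mulrC.
by have := truncnS_gt (r * ln #|D|%:R : R).
Qed.

End HittingSet.

(** * Incidences of points and pseudolines *)

Section Pseudolines.
Variables (R : realType) (T C : finType).
Variables (px py : T -> R) (g : C -> R -> R) (sl : C -> R) (top bot : C).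
Hypothesis point_inj : forall p q, px p = px q -> py p = py q -> p = q.
(** The pseudoline axiom: [sl] acts as a slope, and the curve of larger slope, once level with the
    other or above it, stays strictly above. Curves are compared only at abscissas of points. *)
Hypothesis g_cross : forall i j p q, sl i < sl j -> px p < px q ->
  g i (px p) <= g j (px p) -> g i (px q) < g j (px q).
Hypothesis g_parallel : forall i j p q, sl i = sl j ->
  g i (px p) <= g j (px p) -> g i (px q) <= g j (px q).
Hypothesis g_disjoint : forall i j p, sl i = sl j ->
  g i (px p) = g j (px p) -> i = j.
Hypothesis g_bot : forall p, g bot (px p) < py p.
Hypothesis g_top : forall p, py p < g top (px p).

(* The vertical order of the curves immediately to the right of abscissa [x]. *)
Definition below (x : R) (i j : C) : bool :=
  (g i x < g j x) || ((g i x == g j x) && (sl i < sl j)).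

Lemma below_irr x i : below x i i = false.
Proof. by rewrite /below !ltxx andbF. Qed.

Lemma below_le x i j : below x i j -> g i x <= g j x.
Proof. by case/orP => [/ltW//|/andP[/eqP->]]. Qed.

Lemma below_trans x : transitive (below x).
Proof.
move=> j i k; rewrite /below => /orP[ij|/andP[/eqP-> sij]] /orP[jk|/andP[/eqP<- sjk]].
- by rewrite (lt_trans ij jk).
- by rewrite ij.
- by rewrite jk.
- by rewrite eqxx (lt_trans sij sjk) orbT.
Qed.

Lemma below_asym x i j : below x i j -> below x j i = false.
Proof. by move=> ij; apply/negP => /(below_trans ij); rewrite below_irr. Qed.

Lemma below_total p i j : i != j -> below (px p) i j || below (px p) j i.
Proof.
move=> ij; rewrite /below eq_sym.
case: (ltgtP (g i (px p)) (g j (px p))) => //= e.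
case: (ltgtP (sl i) (sl j)) => //= s.
by move: ij; rewrite (g_disjoint s e) eqxx.
Qed.

Lemma not_below p i j : ~~ below (px p) i j -> i = j \/ below (px p) j i.
Proof.
have [->|/(below_total p)/orP[->|->]] := eqVneq i j; by [left|right].
Qed.

Lemma not_below_le p i j : ~~ below (px p) i j -> g j (px p) <= g i (px p).
Proof. by move=> /not_below[->//|/below_le]. Qed.

Lemma below_mono p q i j : sl i <= sl j -> px p <= px q ->
  below (px p) i j -> below (px q) i j.
Proof.
rewrite le_eqVlt => /predU1P[s|s]; rewrite le_eqVlt => /predU1P[<-//|pq] b.
  have : i != j by apply: contraTneq b => ->; rewrite below_irr.
  move=> /(below_total q)/orP[//|/below_le/g_parallel ji].
  have /le_anti e := introT andP (conj (ji p (esym s)) (below_le b)).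
  by move: b; rewrite (g_disjoint s (esym e)) below_irr.
by rewrite /below (g_cross s pq (below_le b)).
Qed.

(** From left to right the order of two curves changes at most once, so if it agrees at both ends it
    is constant in between. *)
Lemma below_convex p q s i j : px p <= px q -> px q <= px s ->
  below (px p) i j = below (px s) i j -> below (px q) i j = below (px p) i j.
Proof.
wlog sij : i j / sl i <= sl j => [hwlog|pq qs e].
  have [/hwlog//|/ltW sji pq qs] := leP (sl i) (sl j).
  have [->|nij] := eqVneq i j; first by rewrite !below_irr.
  have flip t : below (px t) i j = ~~ below (px t) j i.
    have /orP[h|h] := below_total t nij; first by rewrite h (below_asym h).
    by rewrite h (below_asym h).
  rewrite !flip => /(can_inj negbK) e; congr (~~ _); exact: hwlog e.
apply/idP/idP => [/(below_mono sij qs)|/(below_mono sij pq)//].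
by rewrite -e.
Qed.

Lemma crossing_unique p q i j : i != j -> g i (px p) = g j (px p) ->
  g i (px q) = g j (px q) -> px p = px q.
Proof.
wlog pq : p q / px p <= px q => [hwlog ij ep eq|].
  by have [/hwlog|/ltW/hwlog/(_ ij eq ep)] := leP (px p) (px q); [exact|].
move: pq; rewrite le_eqVlt => /predU1P[//|pq].
wlog sij : i j / sl i <= sl j => [hwlog ij ep eq|ij ep eq].
  have [/hwlog|/ltW/hwlog] := leP (sl i) (sl j); first exact.
  by apply; rewrite // eq_sym.
move: sij; rewrite le_eqVlt => /predU1P[s|s].
  by move: ij; rewrite (g_disjoint s ep) eqxx.
by have := g_cross s pq; rewrite ep lexx eq ltxx => /(_ isT).
Qed.

Lemma below_min p (A : pred C) i0 : A i0 ->
  exists2 i, A i & forall k, A k -> ~~ below (px p) k i.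
Proof.
move=> Ai0; pose N i := #|[pred k | A k && below (px p) k i]|.
case: (arg_minnP N Ai0) => i Ai imin; exists i => // k Ak; apply/negP => ki.
have := imin k Ak; rewrite leqNgt => /negP; apply.
apply: proper_card; apply/properP; split.
  by apply/fintype.subsetP => l; rewrite !inE => /andP[-> /below_trans->].
by exists k; rewrite !inE Ak ?ki// below_irr.
Qed.

Lemma below_max p (A : pred C) i0 : A i0 ->
  exists2 i, A i & forall k, A k -> ~~ below (px p) i k.
Proof.
move=> Ai0; pose N i := #|[pred k | A k && below (px p) i k]|.
case: (arg_minnP N Ai0) => i Ai imin; exists i => // k Ak; apply/negP => ki.
have := imin k Ak; rewrite leqNgt => /negP; apply.
apply: proper_card; apply/properP; split.
  by apply/fintype.subsetP => l; rewrite !inE => /andP[-> /(below_trans ki)->].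
by exists k; rewrite !inE Ak ?ki// below_irr.
Qed.

(** * Trapezoidal cells cut out by a sample of curves *)

Section Cells.
Variable S : {set C}.
Hypothesis S_top : top \in S.
Hypothesis S_bot : bot \in S.

Definition on_sample p : bool := [exists i in S, g i (px p) == py p].

(** The last clause says that [u] is the immediate predecessor of [t] in the sample. It mentions
    only the order of curves, so it can be carried to other abscissas where that order is the
    same. *)
Definition squeezed p t u : Prop :=
  [/\ t \in S, u \in S, g u (px p) < py p, py p < g t (px p) &
      forall k, k \in S -> below (px p) k t = (k == u) || below (px p) k u].

Lemma squeezed_ex p : ~~ on_sample p -> exists t u, squeezed p t u.
Proof.
move=> off.
have [|t /andP[tS pt] tmin] :=
    @below_min p [pred i | (i \in S) && (py p < g i (px p))] top.
  by rewrite /= S_top g_top.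
have [|u /andP[uS up] umax] :=
    @below_max p [pred i | (i \in S) && (g i (px p) < py p)] bot.
  by rewrite /= S_bot g_bot.
exists t, u; split=> // k kS; apply/idP/orP => [kt|[/eqP->|/below_le ku]].
- have kp : g k (px p) < py p.
    rewrite lt_neqAle leNgt; apply/andP; split.
      by apply: contra off => kp; apply/existsP; exists k; rewrite kS.
    by apply/negP => pk; move: kt; apply/negP/tmin; rewrite /= kS.
  have /umax/not_below[->|] : [pred i | (i \in S) && (g i (px p) < py p)] k.
  - by rewrite /= kS.
  - by left.
  - by right.
- by rewrite /below (lt_trans up pt).
- by rewrite /below (le_lt_trans ku (lt_trans up pt)).
Qed.

Definition same_order p q j : bool :=
  [forall k in S, below (px p) k j == below (px q) k j].

Lemma same_orderP p q j :
  reflect (forall k, k \in S -> below (px p) k j = below (px q) k j) (same_order p q j).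
Proof.
by apply: (iffP forall_inP) => h k kS; [apply/eqP|apply/eqP]; exact: h.
Qed.

(* The cell of [p] ends on the left where [k] meets one of its two boundary
   curves [c]; the degenerate value [k = c] marks the cells that extend to
   the leftmost abscissa. *)
Definition left_end p t u c k : Prop := exists q0,
  [/\ same_order p q0 t, same_order p q0 u,
      forall q, px q < px q0 -> below (px q) k c != below (px q0) k c &
      k != c -> exists q, px q < px q0].

(** A key is a flag telling whether the cell starts on its upper or its lower boundary, that
    boundary curve, and the sample curve met there. There are [2 |S|^2] keys, which bounds the
    number of cells. *)
Definition keyed p (kappa : bool * C * C) t u : Prop :=
  [/\ squeezed p t u, kappa.2 \in S, kappa.1.2 = (if kappa.1.1 then t else u) &
      left_end p t u kappa.1.2 kappa.2].

Lemma keyed_ex p : ~~ on_sample p -> exists kappa t u, keyed p kappa t u.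
Proof.
move=> /squeezed_ex[t [u sq]]; have [tS uS _ _ _] := sq.
have Pp : same_order p p t && same_order p p u.
  by apply/andP; split; apply/same_orderP.
(* Here [q0] is the leftmost abscissa with the same order around [t] and [u], and [q2] below is the
   one just before it. Some sample curve [k] changes sides with [t] or [u] between the two, and by
   convexity it is on the other side everywhere left of [q0]. *)
case: (arg_minP (P := fun q => same_order p q t && same_order p q u) px Pp)
  => q0 /andP[q0t q0u] q0min.
have [/existsP[q1 q1q0]|noleft] := boolP [exists q, px q < px q0]; last first.
  exists (true, t, t), t, u; split=> //; exists q0; split=> //; last by rewrite eqxx.
  move=> q qq0; case/negP: noleft; by apply/existsP; exists q.
case: (arg_maxP (P := fun q => px q < px q0) px q1q0) => q2 q2q0 q2max.
have : ~~ (same_order p q2 t && same_order p q2 u).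
  by apply/negP => /q0min; rewrite leNgt q2q0.
have key j k : (j = t \/ j = u) -> k \in S -> below (px p) k j != below (px q2) k j ->
    forall q, px q < px q0 -> below (px q) k j != below (px q0) k j.
  move=> jtu kS neq q qq0; apply: contraNneq neq => e.
  have e0 : below (px p) k j = below (px q0) k j.
    by case: jtu => ->; [move/same_orderP: q0t|move/same_orderP: q0u]; apply.
  by rewrite e0 (below_convex (q2max q qq0) (ltW q2q0) e) e.
have neqj j k : below (px p) k j != below (px q2) k j -> k != j.
  by apply: contraNneq => ->; rewrite !below_irr.
rewrite negb_and => /orP[] /forall_inPn[k kS neq].
- exists (true, t, k), t, u; split=> //; exists q0; split=> //.
    by apply: key => //; left.
  by move=> _; exists q2.
- exists (false, u, k), t, u; split=> //; exists q0; split=> //.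
    by apply: key => //; right.
  by move=> _; exists q2.
Qed.

(** The curves [k] and [c] exchange their order only once, so the pair determines the abscissa where
    the cell starts. *)
Lemma left_end_unique p p' t u t' u' c k : left_end p t u c k ->
  left_end p' t' u' c k ->
  exists q0 q0', [/\ px q0 = px q0', same_order p q0 t, same_order p q0 u,
    same_order p' q0' t' & same_order p' q0' u'].
Proof.
have half q0 q0' :
    (forall q, px q < px q0 -> below (px q) k c != below (px q0) k c) ->
    (forall q, px q < px q0' -> below (px q) k c != below (px q0') k c) ->
    (k != c -> exists q, px q < px q0') -> px q0 <= px q0'.
  move=> h h' left'; rewrite leNgt; apply/negP => lt.
  have ne := h _ lt.
  have kc : k != c by apply: contraNneq ne => ->; rewrite !below_irr.
  have [q qq0'] := left' kc.
  (* The values of [below] at [q], [q0'] and [q0] would be three pairwise distinct booleans. *)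
  have := h' _ qq0'; have := h _ (lt_trans qq0' lt); move: ne.
  by do 3!case: below.
move=> [q0 [h1 h2 h3 h4]] [q0' [h1' h2' h3' h4']].
exists q0, q0'; split=> //.
by apply/le_anti/andP; split; exact: half.
Qed.

(** The key names one of the two boundaries. The other is its neighbour in the sample order at the
    common left end. *)
Lemma keyed_unique p p' kappa t u t' u' :
  keyed p kappa t u -> keyed p' kappa t' u' ->
  [/\ t = t', u = u', same_order p p' t & same_order p p' u].
Proof.
case: kappa => [[b c] k] [[tS uS _ _ sq] /= _ ec le] [[tS' uS' _ _ sq'] /= _ ec' le'].
have [q0 [q0' [e q0t q0u q0t' q0u']]] := left_end_unique le le'.
move/same_orderP: q0t => q0t; move/same_orderP: q0u => q0u.
move/same_orderP: q0t' => q0t'; move/same_orderP: q0u' => q0u'.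
have sq0 l : l \in S -> below (px q0) l t = (l == u) || below (px q0) l u.
  by move=> lS; rewrite -q0t// -q0u// sq.
have sq0' l : l \in S -> below (px q0) l t' = (l == u') || below (px q0) l u'.
  by move=> lS; rewrite e -q0t'// -q0u'// sq'.
have [et eu] : t = t' /\ u = u'.
  case: b ec ec' => -> ej; subst; split=> //.
    have h l (lS : l \in S) := etrans (esym (sq0 l lS)) (sq0' l lS).
    have := h _ uS'; have := h _ uS; rewrite !eqxx /= eq_sym.
    case: eqVneq => //= _ /esym uu' u'u.
    by rewrite (below_asym uu') in u'u.
  have h l (lS : l \in S) := etrans (sq0 l lS) (esym (sq0' l lS)).
  have := h _ tS'; have := h _ tS; rewrite !below_irr.
  have [//|/(below_total q0)] := eqVneq t t'.
  by case: below => //=; case: below.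
subst t' u'; split=> //; apply/same_orderP => l lS.
  by rewrite q0t// q0t'// e.
by rewrite q0u// q0u'// e.
Qed.

(** A cell is coded by its upper and lower curves and its extreme points. This type has
    [|C|^2 |T|^2] elements and does not depend on the sample, so a sample hitting all heavy cells
    can be chosen in advance. *)
Definition region (cell : C * C * T * T) p : bool :=
  [&& px cell.1.2 <= px p, px p <= px cell.2,
      g cell.1.1.2 (px p) < py p & py p < g cell.1.1.1 (px p)].

Definition crossing (cell : C * C * T * T) : {set C} :=
  [set c | [exists p, region cell p && (g c (px p) == py p)]].

(** The sample is ordered alike around [t] and [u] at both ends, hence throughout the region, so no
    sample curve ever passes between [u] and [t]. *)
Lemma region_avoids t u ql qr :
  (forall k, k \in S -> below (px ql) k t = (k == u) || below (px ql) k u) ->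
  same_order ql qr t -> same_order ql qr u ->
  [disjoint crossing (t, u, ql, qr) & S].
Proof.
move=> sq /same_orderP ot /same_orderP ou.
rewrite disjoint_subset; apply/fintype.subsetP => k.
rewrite !inE => /existsP[p /andP[/and4P[/= lp pr up pt] /eqP kp]].
apply/negP => kS.
have : below (px p) k t = (k == u) || below (px p) k u.
  rewrite (below_convex lp pr (ot _ kS)) (below_convex lp pr (ou _ kS)).
  exact: sq.
have [/below_le|/not_below_le] := boolP (below (px p) k t).
  rewrite kp => _ /esym/orP[/eqP ku|/below_le].
    by move: up; rewrite -ku kp ltxx.
  by rewrite kp leNgt up.
by rewrite kp leNgt pt.
Qed.

(** Points with the same key lie between the same two sample curves; their cell is the trapezoid
    between these curves from the leftmost to the rightmost such point. *)
Lemma cell_decomposition : exists K : T -> bool * C * C,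
  forall p, ~~ on_sample p ->
    [/\ (K p).1.2 \in S, (K p).2 \in S &
      exists2 cell, [disjoint crossing cell & S] &
        forall q, ~~ on_sample q -> K q = K p -> region cell q].
Proof.
have [K0 _] : exists K0 : T -> bool * C * C, True by exists (fun=> (true, top, top)).
have : forall p, exists kappa, ~~ on_sample p -> exists t u, keyed p kappa t u.
  move=> p; have [on|/keyed_ex[kappa h]] := boolP (on_sample p); last by exists kappa.
  by exists (K0 p).
move=> /boolp.choice[K Kp]; exists K => p off.
have [t [u pkey]] := Kp p off; have [sqp ? e [q0 _]] := pkey.
have [tS uS up pt sq] := sqp.
split=> //; first by rewrite e; case: ifP.
pose cls q := ~~ on_sample q && (K q == K p).
have clsP q : cls q -> [/\ squeezed q t u, same_order p q t & same_order p q u].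
  case/andP => offq /eqP Kq; have [t' [u' qkey]] := Kp q offq.
  rewrite Kq in qkey; have [et eu ? ?] := keyed_unique pkey qkey.
  by split=> //; have [] := qkey; rewrite et eu.
have clsp : cls p by rewrite /cls off eqxx.
case: (arg_minP px clsp) => ql /[dup] /clsP[[_ _ _ _ sql] olt olu] _ qlmin.
case: (arg_maxP px clsp) => qr /[dup] /clsP[_ ort oru] _ qrmax.
exists (t, u, ql, qr).
  apply: region_avoids => //; apply/same_orderP => k kS.
    by move/same_orderP: olt => <-//; move/same_orderP: ort => <-.
  by move/same_orderP: olu => <-//; move/same_orderP: oru => <-.
move=> q offq Kq; have clsq : cls q by rewrite /cls offq Kq eqxx.
have [[_ _ uq qt _] _ _] := clsP _ clsq.
by apply/and4P; split=> //; [exact: qlmin|exact: qrmax].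
Qed.

End Cells.

(** * Counting incidences cell by cell *)

Definition inc (c : C) (p : T) : bool := g c (px p) == py p.

Lemma inc_unique c i p q : c != i -> inc c p -> inc i p -> inc c q -> inc i q -> p = q.
Proof.
move=> ci /eqP cp /eqP ip /eqP cq /eqP iq.
have e : px p = px q by apply: (crossing_unique ci); rewrite ?cp ?ip ?cq ?iq.
by apply: point_inj => //; rewrite -cp -cq e.
Qed.

(** The left side counts triples of a curve and two points on it. Two distinct points share at most
    one curve, and the diagonal triples are the incidences. *)
Lemma kst_sqr (A : {set T}) (B : {set C}) :
  (\sum_(c in B) (\sum_(p in A) inc c p) ^ 2 <=
   #|A| ^ 2 + \sum_(c in B) \sum_(p in A) inc c p)%N.
Proof.
under eq_bigr do rewrite -mulnn big_distrlr /=.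
rewrite exchange_big /= [X in (_ <= _ + X)%N]exchange_big /= -mulnn.
rewrite -!sum_nat_const -big_split /=; apply: leq_sum => p pA.
rewrite exchange_big /= (bigD1 p pA) /= addnC -sum1_card [X in (_ <= X + _)%N](bigD1 p pA) /=.
rewrite leq_add//; last by apply: leq_sum => c _; case: (inc c p).
rewrite (leq_trans _ (leq_addl _ _))//; apply: leq_sum => q /andP[qA qp].
have [c0 /andP[/andP[c0B c0p] c0q]|none] :=
    pickP [pred c | (c \in B) && inc c p && inc c q]; last first.
  rewrite big1// => c cB; move: (none c) => /=; rewrite cB /=.
  by rewrite mulnb => ->.
rewrite (bigD1 c0)//= c0p c0q big1 ?addn0// => c /andP[_ cc0].
case cp : (inc c p); case cq : (inc c q) => //.
by case/eqP: qp; apply/esym; exact: inc_unique cc0 cp c0p cq c0q.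
Qed.

(** A natural number [d] satisfies [d <= 1 + th] or [d < d (d - 1) / th]. Summed over the curves
    with [kst_sqr], this gives at most [M (1 + th) + |A|^2 / th], and [th = |A| / sqrt M] balances
    the two terms. *)
Lemma kst (A : {set T}) (B : {set C}) (M : R) : 0 < M -> #|B|%:R <= M ->
  (\sum_(p in A) \sum_(c in B) inc c p)%N%:R <= M + 2 * #|A|%:R * Num.sqrt M.
Proof.
move=> M0 BM; rewrite exchange_big /=.
have [->|] := eqVneq A finset.set0.
  by rewrite cards0 mulr0 mul0r addr0 big1 ?ltW// => c _; rewrite big_set0.
rewrite -card_gt0 -(ltr0n R) => A0.
have := kst_sqr A B; set d := fun c => (\sum_(p in A) inc c p)%N.
rewrite -(ler_nat R) natrD natrX !natr_sum => sqr_le.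
have sM : 0 < Num.sqrt M by rewrite sqrtr_gt0.
have MM : Num.sqrt M ^+ 2 = M by rewrite sqr_sqrtr// ltW.
set th := #|A|%:R / Num.sqrt M.
have th0 : 0 < th by rewrite divr_gt0.
have d_le c : (d c)%:R <= 1 + th + th^-1 * ((d c ^ 2)%N%:R - (d c)%:R).
  rewrite natrX; set x : R := (d c)%:R.
  rewrite -(ler_pM2l th0) mulrDr mulrA divff ?gt_eqF// mul1r.
  have [] : x = 0 \/ 1 <= x.
    by rewrite /x; case: (d c) => [|k]; [left|right; rewrite ler1n].
  - by move=> ->; nra.
  - have := sqr_ge0 (x - th); nra.
have : \sum_(c in B) (d c)%:R <=
    \sum_(c in B) (1 + th + th^-1 * ((d c ^ 2)%N%:R - (d c)%:R)).
  by apply: ler_sum.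
rewrite big_split /= sumr_const -mulr_sumr sumrB -[_ *+ #|B|]mulr_natl => /le_trans; apply.
rewrite (le_trans (_ : _ <= #|B|%:R * (1 + th) + th^-1 * #|A|%:R ^+ 2))//.
  by rewrite lerD2l ler_pM2l ?invr_gt0// lerBlDr.
rewrite (le_trans (_ : _ <= M * (1 + th) + th^-1 * #|A|%:R ^+ 2))//.
  by rewrite lerD2r ler_wpM2r// addr_ge0// ltW.
rewrite mulrDr mulr1 -addrA lerD2l /th -{1}MM.
rewrite le_eqVlt; apply/orP; left; apply/eqP; field.
by rewrite !gt_eqF.
Qed.

(** A point meets at most [|S|] sample curves, and a curve outside [S] meets each sample curve in at
    most one point, so it contains at most [|S|] points of the sample curves. *)
Lemma on_sample_incidences (S : {set C}) :
  (\sum_(p | on_sample S p) \sum_c inc c p <= (#|T| + #|C|) * #|S|)%N.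
Proof.
under eq_bigr do rewrite (bigID (mem S)) /=.
rewrite big_split mulnDl; apply: leq_add.
  apply: (@leq_trans (\sum_(p : T) #|S|)); last by rewrite sum_nat_const.
  rewrite big_mkcond; apply: leq_sum => p _; case: ifP => // _.
  by rewrite -sum1_card; apply: leq_sum => c _; case: inc.
rewrite exchange_big /= -sum_nat_const big_mkcond; apply: leq_sum => c _.
case: ifP => // cS.
apply: (@leq_trans (\sum_(p : T) \sum_(i in S) (inc c p && inc i p))).
  rewrite big_mkcond; apply: leq_sum => p _; case: ifP => // /existsP[i /andP[iS ip]].
  have {}ip : inc i p by [].
  by rewrite (bigD1 i)//= ip andbT leq_addr.
rewrite exchange_big -sum1_card; apply: leq_sum => i iS /=.
have ci : c != i by apply: contraNneq cS => ->.
have [p /andP[cp ip]|none] := pickP [pred p | inc c p && inc i p]; last first.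
  by rewrite big1// => p _; have /= -> := none p.
rewrite (bigD1 p)//= cp ip big1// => q qp.
apply/eqP; rewrite eqb0; apply: contraNN qp => /andP[cq iq].
by apply/eqP; exact: inc_unique ci cq iq cp ip.
Qed.

(** [kst] is applied to each key class with the curves crossing its cell. The term [M] is paid once
    per key, and the class sizes add up to at most [|T|]. *)
Lemma off_sample_incidences (S : {set C}) (M : R) : top \in S -> bot \in S -> 0 < M ->
  (forall cell, [disjoint crossing cell & S] -> #|crossing cell|%:R <= M) ->
  (\sum_(p | ~~ on_sample S p) \sum_c inc c p)%N%:R <=
    2 * #|S|%:R ^+ 2 * M + 2 * #|T|%:R * Num.sqrt M.
Proof.
move=> S_top S_bot M0 light.
have [K KP] := cell_decomposition S_top S_bot.
pose Q := finset.setX (finset.setX [set: bool] S) S.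
have KQ p : ~~ on_sample S p -> K p \in Q.
  by move=> /KP[c1 c2 _]; rewrite /Q [K p]surjective_pairing [(K p).1]surjective_pairing !inE /= c1.
rewrite (partition_big K (mem Q)) //= natr_sum.
have cQ : #|Q|%:R = 2 * #|S|%:R ^+ 2 :> R.
  by rewrite !cardsX cardsT card_bool !natrM expr2 mulrA.
pose A kappa := [set p | ~~ on_sample S p & K p == kappa].
apply: (@le_trans _ _ (\sum_(kappa in Q) (M + 2 * #|A kappa|%:R * Num.sqrt M))).
  apply: ler_sum => kappa _.
  have [A0|[p]] := set_0Vmem (A kappa).
    rewrite big1 ?addr_ge0 ?mulr_ge0 ?sqrtr_ge0// ?ltW// => p pA.
    by have : p \in A kappa; [rewrite inE | rewrite A0 inE].
  rewrite inE => /andP[off /eqP Kp]; have [_ _ [cell cellS cellP]] := KP p off.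
  apply: le_trans (kst _ M0 (light _ cellS)); rewrite ler_nat.
  rewrite [leqRHS](eq_bigl (fun p => ~~ on_sample S p && (K p == kappa))); last first.
    by move=> q; rewrite inE.
  apply: leq_sum => q /andP[offq /eqP Kq].
  rewrite [leqRHS]big_mkcond; apply: leq_sum => c _; case: ifP => // /negP cN.
  case cq : (inc c q) => //; case: cN; rewrite inE; apply/existsP; exists q.
  by rewrite cellP// Kq Kp.
rewrite big_split /= sumr_const -[_ *+ #|Q|]mulr_natl cQ lerD2l -mulr_suml -mulr_sumr.
rewrite ler_wpM2r ?sqrtr_ge0// ler_wpM2l// -natr_sum ler_nat.
rewrite -sum1_card [leqRHS](bigID (fun p => on_sample S p)) /= (leq_trans _ (leq_addl _ _))//.
rewrite [leqRHS](partition_big K (mem Q))//=; apply: leq_sum => kappa _.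
by rewrite -sum1_card; apply: eq_leq; apply: eq_bigl => p; rewrite inE.
Qed.

Lemma incidence_bound (r L : R) : 1 <= r -> (0 < #|T|)%N ->
  ln #|{: C * C * T * T}|%:R + 3 <= L ->
  (\sum_p \sum_c inc c p)%N%:R <=
    2 * (r * L) ^+ 2 * (#|C|%:R / r) + 2 * #|T|%:R * Num.sqrt (#|C|%:R / r) +
    (#|T|%:R + #|C|%:R) * (r * L).
Proof.
move=> r1 T0 hL.
have r0 : 0 < r by apply: lt_le_trans r1.
have C0 : (0 < #|C|)%N by apply/card_gt0P; exists top.
have M0 : 0 < #|C|%:R / r :> R by rewrite divr_gt0// ltr0n.
(* Light cells need no hitting; they receive all of [C] so that every set of the family is large. *)
pose X cell := if #|C|%:R <= r * #|crossing cell|%:R then crossing cell else [set: C].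
have Xl cell : #|C|%:R <= r * #|X cell|%:R.
  rewrite /X; case: ifP => // _; rewrite cardsT.
  by rewrite ler_peMl.
have [|S0 S0s hit] := hitting_set r1 Xl C0; first by rewrite !card_prod !muln_gt0 C0 T0.
(* The two extreme curves and the [+ 1] of [hitting_set] account for the 3 in the hypothesis on [L],
   since [1 <= r]. *)
pose S := (top |: (bot |: S0))%SET.
have Ss : #|S|%:R <= r * L.
  rewrite (le_trans (_ : _ <= (1 + (1 + #|S0|))%N%:R))//.
    by rewrite ler_nat !cardsU1 !leq_add ?leq_b1.
  rewrite !natrD; move: S0s hL; set l := ln _; nra.
have light cell : [disjoint crossing cell & S] -> #|crossing cell|%:R <= #|C|%:R / r.
  move=> dis; rewrite ler_pdivlMr// mulrC leNgt; apply/negP => heavy.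
  case/negP: (hit cell); rewrite /X ltW//.
  apply: disjointWr dis; apply/fintype.subsetP => c cS; rewrite !inE cS.
  by rewrite !orbT.
have St : top \in S by rewrite !inE eqxx.
have Sb : bot \in S by rewrite !inE eqxx orbT.
have off := off_sample_incidences St Sb M0 light.
rewrite (bigID (on_sample S)) /= natrD addrC.
apply: lerD.
  apply: le_trans off _; rewrite lerD2r ler_wpM2r ?(ltW M0)// ler_pM2l//.
  by rewrite lerXn2r// nnegrE// (le_trans _ Ss).
apply: le_trans (_ : ((#|T| + #|C|) * #|S|)%N%:R <= _).
  by rewrite ler_nat on_sample_incidences.
by rewrite natrM natrD ler_wpM2l.
Qed.

End Pseudolines.

(** * Unit distances in the real plane *)

Section ArchGraph.
Variable R : realType.
Implicit Types x y z : R.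

(* The unit circle near its highest point, continued by downward parabolas so
   that the graph is strictly concave and defined on the whole line. *)
Definition arch x : R :=
  if `|x| <= 4 / 5 then Num.sqrt (1 - x ^+ 2)
  else 3 / 5 - 4 / 3 * (`|x| - 4 / 5) - (`|x| - 4 / 5) ^+ 2.

Lemma archN x : arch (- x) = arch x.
Proof. by rewrite /arch normrN sqrrN. Qed.

Lemma arch_inner x : `|x| <= 4 / 5 -> 3 / 5 <= arch x /\ x ^+ 2 + arch x ^+ 2 = 1.
Proof.
move=> hx; rewrite /arch hx.
have x2 : x ^+ 2 <= (4 / 5) ^+ 2.
  by rewrite -real_normK ?num_real// lerXn2r// nnegrE// ?normr_ge0; lra.
have h0 : 0 <= 1 - x ^+ 2 by lra.
split; last by rewrite sqr_sqrtr//; ring.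
by rewrite -(ler_pXn2r (_ : (0 < 2)%N)) ?nnegrE ?sqrtr_ge0// ?sqr_sqrtr//; lra.
Qed.

Lemma arch_right x : 4 / 5 < x -> arch x = 3 / 5 - 4 / 3 * (x - 4 / 5) - (x - 4 / 5) ^+ 2.
Proof. by move=> hx; rewrite /arch ger0_norm ?leNgt ?hx//; lra. Qed.

Lemma arch_left x : x < - (4 / 5) -> arch x = 3 / 5 + 4 / 3 * (x + 4 / 5) - (x + 4 / 5) ^+ 2.
Proof. by move=> hx; rewrite -archN arch_right; [ring|lra]. Qed.

Lemma arch_zone x : [\/ `|x| <= 4 / 5, 4 / 5 < x | x < - (4 / 5)].
Proof.
have [|h] := leP `|x| (4 / 5); first by constructor 1.
have [x0|x0] := leP 0 x.
  by constructor 2; move: h; rewrite ger0_norm.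
by constructor 3; move: h; rewrite ltr0_norm//; lra.
Qed.

(** Strict concavity, expressed by strict supporting lines. The slope [phi] is that of the tangent
    to the circle or to the parabola; at the rational point [(4/5, 3/5)] both are [- 4/3], so the
    pieces join smoothly. *)
Lemma arch_supergradient_pos z : 0 <= z ->
  exists phi, forall y, y != z -> arch y < arch z + phi * (y - z).
Proof.
move=> z0.
have tangent u v : `|u| <= 4 / 5 -> `|v| <= 4 / 5 -> u * v + arch u * arch v <= 1.
  move=> /arch_inner[_ hu] /arch_inner[_ hv].
  have := sqr_ge0 (u - v); have := sqr_ge0 (arch u - arch v); nra.
have c45 : `|4 / 5 : R| <= 4 / 5 by rewrite ger0_norm; lra.
have arch45 : arch (4 / 5) = 3 / 5.
  have [h1 h2] := arch_inner c45; nra.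
have [zs|zl|] := arch_zone z; last by lra.
  have [f1 f2] := arch_inner zs; set f := arch z in f1 f2 *.
  have z45 : z <= 4 / 5 by rewrite ger0_norm in zs.
  have f0 : f != 0 by lra.
  exists (- z / f) => y yz.
  have main : arch y * f < f ^+ 2 - z * (y - z).
    have [ys|yl|yl] := arch_zone y.
    - have [g1 g2] := arch_inner ys; set g := arch y in g1 g2 *.
      have : 0 < (z - y) ^+ 2 by rewrite exprn_even_gt0//= subr_eq0 eq_sym.
      have := sqr_ge0 (f - g); nra.
    - rewrite arch_right//.
      have := tangent z (4 / 5) zs c45; rewrite arch45 -/f.
      have : 0 < (y - 4 / 5) ^+ 2 by rewrite exprn_even_gt0//= subr_eq0 gt_eqF.
      set d := y - 4 / 5; have -> : y = d + 4 / 5 by rewrite /d; ring.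
      have d0 : 0 < d by rewrite subr_gt0.
      nra.
    - rewrite arch_left//.
      have := tangent z (- (4 / 5)) zs; rewrite normrN archN arch45 -/f => /(_ c45).
      set d := - y - 4 / 5; have -> : y = - d - 4 / 5 by rewrite /d; ring.
      have d0 : 0 < d by rewrite /d; lra.
      have : 0 < d ^+ 2 by rewrite exprn_even_gt0//= gt_eqF.
      nra.
  have fgt0 : 0 < f by lra.
  rewrite -(ltr_pM2r fgt0); apply: (lt_le_trans main).
  by rewrite le_eqVlt; apply/orP; left; apply/eqP; field.
rewrite arch_right//; set d := z - 4 / 5.
have d0 : 0 < d by rewrite subr_gt0.
have zE : z = d + 4 / 5 by rewrite /d; ring.
exists (- 4 / 3 - 2 * d) => y yz.
have [ys|yl|yl] := arch_zone y.
- have := tangent y (4 / 5) ys c45; rewrite arch45.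
  have y45 : y <= 4 / 5 by apply: le_trans ys; exact: ler_norm.
  rewrite zE; nra.
- rewrite arch_right//.
  have : 0 < (y - z) ^+ 2 by rewrite exprn_even_gt0//= subr_eq0.
  rewrite zE; nra.
- rewrite arch_left// zE; nra.
Qed.

Lemma arch_supergradient z : exists phi, forall y, y != z -> arch y < arch z + phi * (y - z).
Proof.
have [/arch_supergradient_pos//|z0] := leP 0 z.
have [|phi h] := @arch_supergradient_pos (- z); first by lra.
exists (- phi) => y yz; have := h (- y); rewrite eqr_opp !archN => /(_ yz); nra.
Qed.

(** Both [u + h] and [v] lie strictly between [u] and [v + h]. Adding the two strict concavity
    inequalities at these points gives the claim, which makes translates of the arch cross at most
    once. *)
Lemma arch_diff_decreasing u v h : u < v -> 0 < h ->
  arch (v + h) - arch v < arch (u + h) - arch u.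
Proof.
move=> uv h0.
have e0 : 0 < v - u by rewrite subr_gt0.
have [phi1 h1] := arch_supergradient (u + h).
have [phi2 h2] := arch_supergradient v.
have n1 : u != u + h by rewrite lt_eqF//; lra.
have n2 : v + h != u + h by rewrite gt_eqF//; lra.
have n3 : u != v by rewrite lt_eqF.
have n4 : v + h != v by rewrite gt_eqF//; lra.
have := h1 _ n1; have := h1 _ n2; have := h2 _ n3; have := h2 _ n4.
set a := arch (v + h); set b := arch v; set c := arch (u + h); set d := arch u.
move=> i1 i2 i3 i4.
have j1 : (v - u) * d + h * a < (v - u + h) * c by nra.
have j2 : h * d + (v - u) * a < (v - u + h) * b by nra.
have : (v - u + h) * (a + d) < (v - u + h) * (b + c) by nra.
rewrite ltr_pM2l; lra.
Qed.

End ArchGraph.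

Section ArchIncidences.
Variables (R : realType) (T C : finType) (tx ty : T -> R) (cx cy : C -> R).
Hypothesis T_inj : forall p q, tx p = tx q -> ty p = ty q -> p = q.
Hypothesis C_inj : forall c d, cx c = cx d -> cy c = cy d -> c = d.

Let graph (c : C) (x : R) : R := cy c + arch (x - cx c).
Let high : R := 1 + \sum_p `|ty p| + \sum_p \sum_c `|graph c (tx p)|.
(** With parameters beyond every [cx c], the lower line comes first and the upper line last in the
    order by slope, in agreement with their never crossing another curve. *)
Let steep : R := 1 + \sum_c `|cx c|.

(* The curves are completed with two horizontal lines, one above and one below
   the whole configuration. *)
Let height (i : C + bool) (x : R) : R :=
  match i with inl c => graph c x | inr b => if b then high else - high end.
Let slope (i : C + bool) : R :=
  match i with inl c => cx c | inr b => if b then steep else - steep end.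

Let le_sum_norm (I : finType) (F : I -> R) i : `|F i| <= \sum_j `|F j|.
Proof. by rewrite (bigD1 i)//= lerDl sumr_ge0. Qed.

Let ty_high p : - high < ty p < high.
Proof.
rewrite -ltr_norml /high; have := le_sum_norm ty p.
have : 0 <= \sum_p \sum_c `|graph c (tx p)| by do 2!apply: sumr_ge0 => ? _.
lra.
Qed.

Let graph_high c p : - high < graph c (tx p) < high.
Proof.
rewrite -ltr_norml /high; have := le_sum_norm (graph^~ (tx p)) c.
have : \sum_c `|graph c (tx p)| <= \sum_p \sum_c `|graph c (tx p)|.
  by rewrite (bigD1 p)//= lerDl; do 2!apply: sumr_ge0 => ? _.
have : 0 <= \sum_p `|ty p| by apply: sumr_ge0.
lra.
Qed.

Let cx_steep c : - steep < cx c < steep.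
Proof. by rewrite -ltr_norml /steep; have := le_sum_norm cx c; lra. Qed.

Let high_gt0 (p : T) : - high < high.
Proof. by have /andP[] := ty_high p; exact: lt_trans. Qed.

Let steep_gt0 : - steep < steep.
Proof. by have : 0 <= \sum_c `|cx c| by [apply: sumr_ge0]; rewrite /steep; lra. Qed.

Let height_cross i j p q : slope i < slope j -> tx p < tx q ->
  height i (tx p) <= height j (tx p) -> height i (tx q) < height j (tx q).
Proof.
case: i j => [c|[]] [d|[]] //=; rewrite ?ltxx//.
- move=> cd pq; rewrite /graph.
  have h0 : 0 < cx d - cx c by rewrite subr_gt0.
  have uv : tx p - cx d < tx q - cx d by rewrite ltrD2r.
  have := arch_diff_decreasing uv h0.
  have -> : tx q - cx d + (cx d - cx c) = tx q - cx c by ring.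
  have -> : tx p - cx d + (cx d - cx c) = tx p - cx c by ring.
  lra.
- by have /andP[_ ?] := graph_high c q.
- by have /andP[? _] := cx_steep c; lra.
- by have /andP[_ ?] := cx_steep d; lra.
- by have := steep_gt0; lra.
- by have /andP[] := graph_high d q.
- by rewrite (high_gt0 p).
Qed.

Let height_parallel i j p q : slope i = slope j ->
  height i (tx p) <= height j (tx p) -> height i (tx q) <= height j (tx q).
Proof.
have := steep_gt0.
case: i j => [c|[]] [d|[]] //=; try by [have := cx_steep c; lra| have := cx_steep d; lra|lra].
by move=> _ e; rewrite /graph e !lerD2r.
Qed.

Let height_disjoint i j p : slope i = slope j ->
  height i (tx p) = height j (tx p) -> i = j.
Proof.
have := steep_gt0.
case: i j => [c|[]] [d|[]] //= s0 e; try by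
  [exfalso; have := cx_steep c; lra| exfalso; have := cx_steep d; lra|exfalso; lra].
by rewrite /graph e => /addIr/(C_inj e) ->.
Qed.

(** Here [w] stands for [(|T| |C|)^(2/3)], constrained through its cube to avoid real powers. [N]
    enters only the logarithm, so that one factor can serve all layers later. *)
Lemma arch_incidences (N : nat) (w : R) :
  (#|T| <= #|C|)%N -> (#|C| <= N)%N -> 0 <= w -> (#|T| * #|C|)%N%:R ^+ 2 <= w ^+ 3 ->
  (\sum_p \sum_c (ty p == cy c + arch (tx p - cx c))%R)%N%:R <=
    30 * (4 * ln (N + 2)%N%:R + 3) ^+ 2 * (w + #|C|%:R).
Proof.
move=> TC CN w0 hw; have l0 : 0 <= ln (N + 2)%N%:R :> R by rewrite ln_ge0// ler1n addn2.
set L := 4 * ln (N + 2)%N%:R + 3.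
have [T0|T0] := posnP #|T|.
  rewrite big1 => [|p _]; last by have := card0_eq T0 p; rewrite inE.
  by rewrite mulr_ge0 ?addr_ge0// mulr_ge0// sqr_ge0.
have C'E : #|{: C + bool}| = (#|C| + 2)%N by rewrite card_sum card_bool.
set n := #|C|%:R : R; set m := #|T|%:R : R; set n' := n + 2.
have n1 : 1 <= n by rewrite ler1n (leq_trans T0).
have m1 : 1 <= m by rewrite ler1n.
have mn : m <= n by rewrite ler_nat.
(* This [r] turns the cell term into [2 L^2 w'], and adding [n'] to [w] ensures [1 <= r]. *)
pose w' := w + n'; pose r := w' / n'.
have n'0 : 0 < n' by rewrite /n'; lra.
have w'0 : 0 < w' by rewrite ltr_wpDl.
have r1 : 1 <= r by rewrite ler_pdivlMr// mul1r lerDr.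
have hL : ln #|{: (C + bool) * (C + bool) * T * T}|%:R + 3 <= L.
  rewrite lerD2r -[4]/(4%N%:R) mulr_natl -lnXn ?ltr0n ?addn2// -natrX ler_ln ?posrE ?ltr0n.
  - rewrite ler_nat !card_prod C'E !expnS expn0 muln1 !mulnA.
    have nN : (#|C| + 2 <= N.+2)%N by rewrite addn2.
    have mN : (#|T| <= N.+2)%N by rewrite (leq_trans TC)// (leq_trans _ nN)// leq_addr.
    exact: leq_mul (leq_mul (leq_mul nN nN) mN) mN.
  - by rewrite !card_prod C'E !muln_gt0 T0 addn2.
  - by rewrite expn_gt0.
have bnd : 2 * (r * L) ^+ 2 * (#|{: C + bool}|%:R / r) +
    2 * #|T|%:R * Num.sqrt (#|{: C + bool}|%:R / r) +
    (#|T|%:R + #|{: C + bool}|%:R) * (r * L) <= 30 * L ^+ 2 * (w + n).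
  rewrite C'E natrD -/n -/m -/n'.
  have L3 : 3 <= L by rewrite /L; lra.
  have rn' : r * n' = w' by rewrite /r divfK// gt_eqF.
  have r0 : 0 < r by lra.
  have -> : 2 * (r * L) ^+ 2 * (n' / r) = 2 * L ^+ 2 * w'.
    by rewrite -rn'; field; rewrite gt_eqF.
  (* Squared, the left side is [(m n')^2 / w']; as [n' <= 3 n], it is at most
     [9 (m n)^2 / w' <= 9 w'^2]. *)
  have msq : m * Num.sqrt (n' / r) <= 3 * w'.
    have nr0 : 0 <= n' / r by rewrite divr_ge0// ltW.
    rewrite -(ler_pXn2r (_ : (0 < 2)%N)) ?nnegrE// ?mulr_ge0 ?sqrtr_ge0 ?(ltW w'0)//.
    rewrite exprMn sqr_sqrtr//.
    have -> : m ^+ 2 * (n' / r) = (m * n') ^+ 2 / w'.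
      by rewrite -rn'; field; rewrite !gt_eqF.
    rewrite ler_pdivrMr//.
    have : (m * n') ^+ 2 <= 9 * (m * n) ^+ 2.
      have -> : 9 * (m * n) ^+ 2 = (3 * (m * n)) ^+ 2 by ring.
      have mn0 : 0 <= m * n by nra.
      have mn'0 : 0 <= m * n' by nra.
      by rewrite lerXn2r ?nnegrE// ?mulr_ge0// /n'; nra.
    move/le_trans; apply; rewrite /m /n -natrM.
    have : w ^+ 3 <= w' ^+ 3 by rewrite lerXn2r ?nnegrE// ?lerDl ltW.
    rewrite exprMn -mulrA -exprSr; lra.
  have w'w : w' <= 3 * (w + n) by rewrite /w' /n'; lra.
  have -> : (m + n') * (r * L) = (m + n') * r * L by ring.
  have mr : (m + n') * r <= 2 * w'.
    by rewrite -rn'; have : m <= n' by [rewrite /n'; lra]; nra.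
  have mrL : (m + n') * r * L <= 2 * w' * L by rewrite ler_wpM2r//; lra.
  have : 10 * L ^+ 2 * w' <= 10 * L ^+ 2 * (3 * (w + n)).
    by rewrite ler_wpM2l// mulr_ge0// sqr_ge0.
  have : 9 * w' <= L ^+ 2 * w' by rewrite ler_pM2r//; nra.
  have : 0 <= (L - 3) * (w' * L) by rewrite !mulr_ge0 ?(ltW w'0)//; lra.
  move: w'w msq mrL; lra.
apply: le_trans bnd.
apply: le_trans (incidence_bound T_inj height_cross height_parallel height_disjoint
  (top := inr true) (bot := inr false) _ _ r1 T0 hL).
- rewrite ler_nat; apply: leq_sum => p _.
  rewrite big_sumType /= (leq_trans _ (leq_addr _ _))//; apply: leq_sum => c _.
  by rewrite /inc /= eq_sym.
- by move=> p /=; have /andP[] := ty_high p.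
- by move=> p /=; have /andP[] := ty_high p.
Qed.

End ArchIncidences.

Section UnitIncidences.
Variables (R : realType) (V : finType).

Lemma arch_set_incidences (X Y : V -> R) (A B : {set V}) (N : nat) (w : R) :
  (forall a b, X a = X b -> Y a = Y b -> a = b) ->
  (#|A| <= #|B|)%N -> (#|B| <= N)%N -> 0 <= w ->
  (#|A| * #|B|)%N%:R ^+ 2 <= w ^+ 3 ->
  (\sum_(a in A) \sum_(b in B) (Y a == Y b + arch (X a - X b))%R)%N%:R <=
    30 * (4 * ln (N + 2)%N%:R + 3) ^+ 2 * (w + #|B|%:R).
Proof.
move=> XY AB BN w0 hw; rewrite big_sub; under eq_bigr do rewrite big_sub.
have inj (D : {set V}) (a b : {x in D}) :
    X (val a) = X (val b) -> Y (val a) = Y (val b) -> a = b.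
  by move=> ex ey; apply/val_inj/XY.
have := @arch_incidences R {a in A} {b in B} (X \o val) (Y \o val) (X \o val) (Y \o val)
  (inj A) (inj B) N w.
by rewrite !card_sig; apply.
Qed.

(** Since [2 (4/5)^2 > 1], one coordinate is at most [4/5] in absolute value, and there the arch is
    the circle. *)
Lemma unit_vector_arch (x y : R) : x ^+ 2 + y ^+ 2 = 1 ->
  [|| y == arch x, - y == arch x, x == arch y | - x == arch y].
Proof.
move=> xy.
have root (s t : R) : s ^+ 2 + t ^+ 2 = 1 -> `|s| <= 4 / 5 -> (t == arch s) || (- t == arch s).
  move=> st /arch_inner[h1 h2]; rewrite eqr_oppLR -eqf_sqr; apply/eqP; lra.
have [xs|xl] := leP `|x| (4 / 5).
  by have /orP[->|->] := root _ _ xy xs; rewrite ?orbT.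
have ys : `|y| <= 4 / 5.
  have c0 : 0 <= 4 / 5 :> R by lra.
  rewrite -(ler_pXn2r (_ : (0 < 2)%N)) ?nnegrE//.
  have : (4 / 5) ^+ 2 < `|x| ^+ 2 by rewrite ltrXn2r// ?nnegrE//; lra.
  rewrite !real_normK ?num_real//; lra.
rewrite addrC in xy.
by have /orP[->|->] := root _ _ xy ys; rewrite ?orbT.
Qed.

Definition unit_pair (X Y : V -> R) a b : bool := (X a - X b) ^+ 2 + (Y a - Y b) ^+ 2 == 1.

Lemma unit_pairC X Y a b : unit_pair X Y a b = unit_pair X Y b a.
Proof. by rewrite /unit_pair -[X a - _]opprB -[Y a - _]opprB !sqrrN. Qed.

(** Negating or exchanging coordinates reduces the four quarter circles to the arch, whence
    [120 = 4 * 30]. *)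
Lemma unit_incidences (X Y : V -> R) (A B : {set V}) (N : nat) (w : R) :
  (forall a b, X a = X b -> Y a = Y b -> a = b) ->
  (#|A| <= N)%N -> (#|B| <= N)%N -> 0 <= w ->
  (#|A| * #|B|)%N%:R ^+ 2 <= w ^+ 3 ->
  (\sum_(a in A) \sum_(b in B) unit_pair X Y a b)%N%:R <=
    120 * (4 * ln (N + 2)%N%:R + 3) ^+ 2 * (w + #|A|%:R + #|B|%:R).
Proof.
move=> XY AN BN w0 hw.
wlog AB : A B AN BN hw / (#|A| <= #|B|)%N => [hwlog|].
  have [/hwlog|/ltnW/hwlog] := leqP #|A| #|B|; first exact.
  rewrite exchange_big addrAC mulnC in hw *; move=> /(_ BN AN hw).
  by under [in X in X -> _]eq_bigr do under eq_bigr do rewrite unit_pairC.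
pose h (X' Y' : V -> R) :=
  (\sum_(a in A) \sum_(b in B) (Y' a == Y' b + arch (X' a - X' b))%R)%N.
have hle X' Y' : (forall a b, X' a = X' b -> Y' a = Y' b -> a = b) ->
    (h X' Y')%:R <= 30 * (4 * ln (N + 2)%N%:R + 3) ^+ 2 * (w + #|B|%:R) :> R.
  by move=> inj; exact: arch_set_incidences.
pose Xn a := - X a; pose Yn a := - Y a.
apply: (@le_trans _ _ (h X Y + h X Yn + h Y X + h Y Xn)%N%:R).
  rewrite ler_nat -!big_split; apply: leq_sum => a _ /=.
  rewrite -!big_split; apply: leq_sum => b _ /=.
  rewrite /unit_pair; case: eqP => //= /unit_vector_arch.
  move=> /or4P[] /eqP e; rewrite lt0n !addn_eq0 !negb_and !eqb0 !negbK.
  - by rewrite (_ : Y a == _)//; apply/eqP; rewrite -e; ring.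
  - by rewrite (_ : Yn a == _) ?orbT//; apply/eqP; rewrite -e /Yn; ring.
  - by rewrite (_ : X a == _) ?orbT//; apply/eqP; rewrite -e; ring.
  - by rewrite (_ : Xn a == _) ?orbT//; apply/eqP; rewrite -e /Xn; ring.
have h1 := hle X Y XY.
have h2 : _ := hle X Yn (fun a b ex ey => XY a b ex (oppr_inj ey)).
have h3 : _ := hle Y X (fun a b ey ex => XY a b ex ey).
have h4 : _ := hle Y Xn (fun a b ey ex => XY a b (oppr_inj ex) ey).
set c := _ ^+ 2 in h1 h2 h3 h4 *; rewrite !natrD.
have : 0 <= c * #|A|%:R by rewrite mulr_ge0// sqr_ge0.
lra.
Qed.

End UnitIncidences.

(** * Energy and layers *)

Section Coincidences.
Variables (R : realType) (U : finType) (K : eqType) (f : U -> K).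

Lemma coincidences_fibers (A B : {set U}) :
  (\sum_(p in A) \sum_(q in B) (f p == f q) =
   \sum_(v <- undup (codom f)) (\sum_(p in A) (f p == v)) * (\sum_(q in B) (f q == v)))%N.
Proof.
under [RHS]eq_bigr do rewrite big_distrlr /=.
rewrite [RHS]exchange_big; apply: eq_bigr => p _; rewrite [RHS]exchange_big.
apply: eq_bigr => q _ /=.
rewrite (bigD1_seq (f p)) ?undup_uniq ?mem_undup ?codom_f//= eqxx mul1n eq_sym.
by rewrite big1 ?addn0// => v /negPf; rewrite eq_sym => ->.
Qed.

(** Grouped by the common value of [f], the coincidences form an inner product, and
    [2 x y <= s x^2 + y^2 / s] applies termwise. *)
Lemma coincidences_le (s : R) (A B : {set U}) : 0 < s ->
  2 * (\sum_(p in A) \sum_(q in B) (f p == f q))%N%:R <=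
  s * (\sum_(p in A) \sum_(q in A) (f p == f q))%N%:R +
  s^-1 * (\sum_(p in B) \sum_(q in B) (f p == f q))%N%:R.
Proof.
move=> s0; rewrite !coincidences_fibers !natr_sum !mulr_sumr -big_split /=.
apply: ler_sum => v _; rewrite !natrM.
set x : R := (\sum_(p in A) _)%:R; set y : R := (\sum_(p in B) _)%:R.
rewrite -(ler_pM2l s0) mulrDr [s * (s^-1 * _)]mulrA divff ?gt_eqF// mul1r.
have := sqr_ge0 (s * x - y); nra.
Qed.

End Coincidences.

(** * From dual unit distances to weighted unit pairs of real parts *)

Section DualUnitDistances.
Variables (R : realType) (U V : finType) (re : U -> V) (X Y : V -> R) (ix iy : U -> R).
Hypothesis XY_inj : forall a b, X a = X b -> Y a = Y b -> a = b.
Hypothesis im_inj : forall p q, re p = re q -> ix p = ix q -> iy p = iy q -> p = q.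
Hypothesis re_surj : forall a, exists p, re p = a.

Let fiber a : {set U} := [set p | re p == a].
Let mul a : nat := #|fiber a|.
Let wt a : R := Num.sqrt (mul a)%:R.
Let proj a b p : R := (X a - X b) * ix p + (Y a - Y b) * iy p.
Let energy a b : nat :=
  (\sum_(p in fiber a) \sum_(q in fiber a) (proj a b p == proj a b q))%N.

Definition dual_unit_pair p q : bool :=
  unit_pair X Y (re p) (re q) &&
  ((X (re p) - X (re q)) * (ix p - ix q) + (Y (re p) - Y (re q)) * (iy p - iy q) == 0).

Let mul_gt0 a : (0 < mul a)%N.
Proof. by have [p <-] := re_surj a; apply/card_gt0P; exists p; rewrite inE. Qed.

Let wt_gt0 a : 0 < wt a.
Proof. by rewrite sqrtr_gt0 ltr0n. Qed.

Let wt_sqr a : wt a ^+ 2 = (mul a)%:R.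
Proof. by rewrite sqr_sqrtr. Qed.

Lemma sum_card_fibers : (\sum_a #|[set p | re p == a]| = #|U|)%N.
Proof.
rewrite -[RHS]sum1_card (partition_big re predT)//=; apply: eq_bigr => a _.
by rewrite -sum1_card; apply: eq_bigl => p; rewrite inE.
Qed.

(* The unit vector from b to a must be orthogonal to the nonzero difference of
   the imaginary parts of p and q. *)
Lemma common_projection_le2 a p q : p != q -> re p = re q ->
  (\sum_(b | unit_pair X Y a b) (proj a b p == proj a b q) <= 2)%N.
Proof.
move=> pq repq.
pose Q := [set b | unit_pair X Y a b & proj a b p == proj a b q].
have -> : (\sum_(b | unit_pair X Y a b) (proj a b p == proj a b q) = #|Q|)%N.
  rewrite -sum1_card big_mkcond [RHS]big_mkcond; apply: eq_bigr => b _.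
  by rewrite inE; case: unit_pair => //=; case: eqP.
pose dx := ix p - ix q; pose dy := iy p - iy q.
have d0 : 0 < dx ^+ 2 + dy ^+ 2.
  rewrite lt_neqAle addr_ge0 ?sqr_ge0// andbT eq_sym paddr_eq0 ?sqr_ge0//.
  rewrite !sqrf_eq0 !subr_eq0; apply: contraNN pq => /andP[/eqP ex /eqP ey].
  by apply/eqP/im_inj.
(* The sign of the determinant with [(dx, dy)] separates the two unit vectors orthogonal to it. The
   square of that determinant is known from Lagrange's identity. *)
pose side b := 0 < (X a - X b) * dy - (Y a - Y b) * dx.
rewrite -(card_in_imset (f := side)); first by rewrite -card_bool max_card.
move=> b c; rewrite !inE /unit_pair => /andP[/eqP b1 /eqP bp] /andP[/eqP c1 /eqP cp].
rewrite /side => eside.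
have {}bp : (X a - X b) * dx + (Y a - Y b) * dy = 0.
  by move: bp; rewrite /proj /dx /dy; lra.
have {}cp : (X a - X c) * dx + (Y a - Y c) * dy = 0.
  by move: cp; rewrite /proj /dx /dy; lra.
move: b1 c1 bp cp eside.
set bx := X a - X b; set by_ := Y a - Y b; set cx := X a - X c; set cy := Y a - Y c.
move=> b1 c1 bp cp.
set s := bx * dy - _; set t := cx * dy - _ => eside.
have s2 : s ^+ 2 = dx ^+ 2 + dy ^+ 2.
  have -> : s ^+ 2 = (bx ^+ 2 + by_ ^+ 2) * (dx ^+ 2 + dy ^+ 2) - (bx * dx + by_ * dy) ^+ 2.
    by rewrite /s; ring.
  by rewrite b1 bp; ring.
have t2 : t ^+ 2 = dx ^+ 2 + dy ^+ 2.
  have -> : t ^+ 2 = (cx ^+ 2 + cy ^+ 2) * (dx ^+ 2 + dy ^+ 2) - (cx * dx + cy * dy) ^+ 2.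
    by rewrite /t; ring.
  by rewrite c1 cp; ring.
have st : s = t.
  have /eqP := etrans s2 (esym t2); rewrite eqf_sqr => /orP[/eqP//|/eqP sNt].
  move: eside s2; rewrite sNt oppr_gt0; case: ltgtP => // t0.
  by rewrite t0 oppr0 expr0n /= => _ e; move: d0; rewrite -e ltxx.
have dn0 : dx ^+ 2 + dy ^+ 2 != 0 by rewrite gt_eqF.
have ex : bx = cx.
  apply: (mulIf dn0); apply/eqP; rewrite -subr_eq0; apply/eqP.
  transitivity (dx * (bx * dx + by_ * dy - (cx * dx + cy * dy)) + dy * (s - t)).
    by rewrite /s /t; ring.
  by rewrite bp cp st !subrr !mulr0 addr0.
have ey : by_ = cy.
  apply: (mulIf dn0); apply/eqP; rewrite -subr_eq0; apply/eqP.
  transitivity (dy * (bx * dx + by_ * dy - (cx * dx + cy * dy)) - dx * (s - t)).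
    by rewrite /s /t; ring.
  by rewrite bp cp st !subrr !mulr0 subr0.
by apply: XY_inj; [move: ex; rewrite /bx /cx|move: ey; rewrite /by_ /cy]; lra.
Qed.

(* AM-GM with the ratio [wt b / wt a], chosen so that the diagonal terms of the
   two energies both contribute [wt a * wt b]. *)
Lemma dual_unit_pairs_energy :
  (\sum_p \sum_q dual_unit_pair p q)%N%:R <=
  \sum_a \sum_(b | unit_pair X Y a b) wt b / wt a * (energy a b)%:R.
Proof.
have fiberE a p : (p \in fiber a) = (re p == a) by rewrite inE.
have split_fibers : (\sum_p \sum_q dual_unit_pair p q =
    \sum_a \sum_(b | unit_pair X Y a b)
      \sum_(p in fiber a) \sum_(q in fiber b) (proj a b p == proj a b q))%N.
  rewrite (partition_big re predT)//=; apply: eq_bigr => a _.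
  under eq_bigr do rewrite (partition_big re predT)//=.
  rewrite exchange_big /= [RHS]big_mkcond; apply: eq_bigr => b _.
  rewrite -(eq_bigl _ _ (fiberE a)).
  case: ifPn => ab.
    apply: eq_bigr => p; rewrite inE => /eqP ep.
    rewrite -(eq_bigl _ _ (fiberE b)).
    apply: eq_bigr => q; rewrite inE => /eqP eq.
    rewrite /dual_unit_pair ep eq ab /= -[in RHS]subr_eq0; congr (nat_of_bool (_ == _)).
    by rewrite /proj; ring.
  rewrite big1// => p; rewrite inE => /eqP ep.
  by rewrite big1// => q /eqP eq; rewrite /dual_unit_pair ep eq (negPf ab).
have energyC a b : (energy b a = \sum_(p in fiber b) \sum_(q in fiber b)
    (proj a b p == proj a b q))%N.
  apply: eq_bigr => p _; apply: eq_bigr => q _; rewrite -eqr_opp.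
  by congr (nat_of_bool (_ == _)); rewrite /proj; ring.
rewrite -(ler_pM2l (_ : 0 < 2 :> R))// split_fibers natr_sum mulr_sumr.
apply: (@le_trans _ _ (\sum_a \sum_(b | unit_pair X Y a b)
    (wt b / wt a * (energy a b)%:R + wt a / wt b * (energy b a)%:R))).
  apply: ler_sum => a _; rewrite natr_sum mulr_sumr; apply: ler_sum => b _.
  rewrite [energy b a](energyC a b) -[wt a / wt b]invf_div.
  apply: coincidences_le.
  by rewrite divr_gt0.
(* Exchanging the names of [a] and [b] turns the second half of the sum into the first, which
   cancels the factor 2. *)
under eq_bigr do rewrite big_split /=.
rewrite big_split /= [X in _ + X](exchange_big_dep predT)//=.
rewrite [X in _ + X](eq_bigr (fun a => \sum_(b | unit_pair X Y a b) wt b / wt a * (energy a b)%:R)).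
  by rewrite mulr_natl mulr2n.
by move=> a _; apply: eq_bigl => b; rewrite unit_pairC.
Qed.

(** The diagonal of the energy contributes [wt a * wt b]. Each of the at most [(mul a)^2] other
    pairs over [a] counts for at most two [b], with weight at most [sqrt M / wt a]; this totals at
    most [2 sqrt M (wt a)^3 <= 2 M mul a]. *)
Lemma dual_unit_pairs_le (M : nat) : (forall a, (mul a <= M)%N) ->
  (\sum_p \sum_q dual_unit_pair p q)%N%:R <=
  \sum_a \sum_(b | unit_pair X Y a b) wt a * wt b + 2 * M%:R * #|U|%:R.
Proof.
move=> mulM; apply: le_trans dual_unit_pairs_energy _.
have wtM a : wt a <= Num.sqrt M%:R by rewrite ler_sqrt// ler_nat.
have energyE a b : (energy a b = mul a + \sum_(p in fiber a)
    \sum_(q in fiber a | q != p) (proj a b p == proj a b q))%N.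
  rewrite /mul -sum1_card -big_split; apply: eq_bigr => p pa /=.
  by rewrite (bigD1 p)//= eqxx.
have -> : 2 * M%:R * #|U|%:R = \sum_a 2 * M%:R * (mul a)%:R :> R.
  by rewrite -mulr_sumr -natr_sum sum_card_fibers.
rewrite -big_split; apply: ler_sum => a _ /=.
under eq_bigr do rewrite energyE natrD mulrDr.
rewrite big_split /=; apply: lerD.
  apply: ler_sum => b _; rewrite -wt_sqr le_eqVlt; apply/orP; left; apply/eqP.
  by field; rewrite gt_eqF.
apply: (@le_trans _ _ (Num.sqrt M%:R / wt a * (2 * (mul a)%:R ^+ 2))).
  apply: (@le_trans _ _ (\sum_(b | unit_pair X Y a b) Num.sqrt M%:R / wt a *
    (\sum_(p in fiber a) \sum_(q in fiber a | q != p) (proj a b p == proj a b q))%N%:R)).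
    by apply: ler_sum => b _; rewrite !ler_wpM2r// invr_ge0 ltW.
  rewrite -mulr_sumr ler_wpM2l ?divr_ge0 ?sqrtr_ge0 ?(ltW (wt_gt0 a))//.
  rewrite -natr_sum -natrX -natrM ler_nat exchange_big /= -mulnn mulnCA.
  rewrite -sum_nat_const; apply: leq_sum => p; rewrite inE => /eqP ep.
  rewrite exchange_big /= mulnC -sum_nat_const big_mkcondr; apply: leq_sum => q.
  rewrite inE => /eqP eq; case: ifP => // qp.
  by apply: common_projection_le2; rewrite ?ep ?eq// eq_sym.
have := wtM a; have := wt_sqr a; have := wt_gt0 a.
move: (wt a) => x x0 <- xM.
have -> : Num.sqrt M%:R / x * (2 * (x ^+ 2) ^+ 2) = 2 * (Num.sqrt M%:R * x) * x ^+ 2.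
  by field; rewrite gt_eqF.
rewrite ler_wpM2r ?sqr_ge0// ler_pM2l//.
by rewrite -[leRHS](@sqr_sqrtr R)// expr2 ler_wpM2l ?sqrtr_ge0.
Qed.

End DualUnitDistances.

(** * Dyadic layers of the multiplicities *)

Section Layers.
Variables (R : realType) (V : finType) (X Y : V -> R) (mul : V -> nat) (n M : nat).
Hypothesis XY_inj : forall a b, X a = X b -> Y a = Y b -> a = b.
Hypothesis mul_gt0 : forall a, (0 < mul a)%N.
Hypothesis mul_le : forall a, (mul a <= M)%N.
Hypothesis sum_mul : (\sum_a mul a = n)%N.

Let layer k : {set V} := [set a | (2 ^ k <= mul a)%N].
Let K := (trunc_log 2 M).+1.
Let rt2 : R := Num.sqrt 2.

Let rt2_gt0 : 0 < rt2.
Proof. by rewrite sqrtr_gt0. Qed.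

Let rt2_sqr : rt2 ^+ 2 = 2.
Proof. by rewrite sqr_sqrtr. Qed.

(** The highest layer containing [a] suffices: if [j] is its index, then [mul a < 2^(j + 1)]. *)
Lemma sqrt_le_layers a :
  Num.sqrt (mul a)%:R <= rt2 * \sum_(k < K) rt2 ^+ k * (a \in layer k)%:R.
Proof.
have /andP[lo hi] := trunc_log_bounds (isT : (1 < 2)%N) (mul_gt0 a).
have kK : (trunc_log 2 (mul a) < K)%N by rewrite ltnS leq_trunc_log.
rewrite (bigD1 (Ordinal kK))//= inE lo mulr1.
apply: (@le_trans _ _ (rt2 * rt2 ^+ trunc_log 2 (mul a))).
  rewrite -exprS -(ler_pXn2r (_ : (0 < 2)%N)) ?nnegrE ?sqrtr_ge0 ?exprn_ge0 ?(ltW rt2_gt0)//.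
  by rewrite sqr_sqrtr// exprAC rt2_sqr -natrX ler_nat ltnW.
rewrite ler_wpM2l ?(ltW rt2_gt0)// lerDl sumr_ge0// => k _.
by rewrite mulr_ge0// exprn_ge0// ltW.
Qed.

Lemma card_layer k : (#|layer k| * 2 ^ k <= n)%N.
Proof.
rewrite -sum_mul -sum_nat_const [leqRHS](bigID (mem (layer k))) /=.
by rewrite (leq_trans _ (leq_addr _ _))//; apply: leq_sum => a; rewrite inE.
Qed.

Lemma weighted_le_layers :
  \sum_a \sum_(b | unit_pair X Y a b) Num.sqrt (mul a)%:R * Num.sqrt (mul b)%:R <=
  2 * \sum_(k < K) \sum_(l < K) rt2 ^+ (k + l) *
    (\sum_(a in layer k) \sum_(b in layer l) unit_pair X Y a b)%N%:R.
Proof.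
pose F a := \sum_(k < K) rt2 ^+ k * (a \in layer k)%:R.
apply: (@le_trans _ _ (2 * \sum_a \sum_b F a * F b * (unit_pair X Y a b)%:R)).
  rewrite mulr_sumr; apply: ler_sum => a _; rewrite big_mkcond mulr_sumr.
  apply: ler_sum => b _; case: ifP => _; last by rewrite !mulr0.
  rewrite mulr1 -rt2_sqr expr2 mulrACA.
  by rewrite ler_pM ?sqrtr_ge0//; exact: sqrt_le_layers.
rewrite ler_pM2l// le_eqVlt; apply/orP; left; apply/eqP.
transitivity (\sum_a \sum_b \sum_(k < K) \sum_(l < K)
    rt2 ^+ (k + l) * ((a \in layer k) * ((b \in layer l) * unit_pair X Y a b))%N%:R).
  apply: eq_bigr => a _; apply: eq_bigr => b _.
  rewrite big_distrlr mulr_suml; apply: eq_bigr => k _ /=.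
  rewrite mulr_suml; apply: eq_bigr => l _ /=.
  by rewrite exprD !natrM; ring.
under eq_bigr do rewrite exchange_big /=.
rewrite exchange_big /=; apply: eq_bigr => k _.
under eq_bigr do rewrite exchange_big /=.
rewrite exchange_big /=; apply: eq_bigr => l _.
rewrite natr_sum mulr_sumr [RHS]big_mkcond; apply: eq_bigr => a _.
case: ifP => al; last by rewrite big1// => b _; rewrite mul0n mulr0.
rewrite natr_sum mulr_sumr [RHS]big_mkcond; apply: eq_bigr => b _.
by rewrite mul1n; case: ifP => _; rewrite ?mul1n ?mul0n ?mulr0.
Qed.

Lemma geometric_sum_le (q : R) (m : nat) : 0 <= q < 1 ->
  \sum_(k < m) q ^+ k <= (1 - q)^-1.
Proof.
move=> /andP[q0 q1]; have q1' : 0 < 1 - q by rewrite subr_gt0.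
rewrite -[leRHS]mul1r ler_pdivlMr//.
have -> : (\sum_(k < m) q ^+ k) * (1 - q) = 1 - q ^+ m.
  by apply/oppr_inj; rewrite -mulrN !opprB mulrC -subrX1.
by rewrite lerBlDr lerDl exprn_ge0.
Qed.

(* Here W = n^(4/3); the layers k and l contribute at most a multiple of
   W q^(k + l) + n M, so the main term sums to O(W). *)
Lemma weighted_incidences (q W : R) : 0 <= q < 1 -> q ^+ 6 = 2^-1 -> (0 < n)%N ->
  0 <= W -> W ^+ 3 = n%:R ^+ 4 ->
  \sum_a \sum_(b | unit_pair X Y a b) Num.sqrt (mul a)%:R * Num.sqrt (mul b)%:R <=
  240 * (4 * ln (n + 2)%N%:R + 3) ^+ 2 *
    (W * (1 - q)^-1 ^+ 2 + 2 * K%:R ^+ 2 * n%:R * M%:R).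
Proof.
move=> q01 q6 n0 W0 W3; have /andP[q0 q1] := q01.
set L := _ ^+ 2; have L0 : 0 <= L by rewrite sqr_ge0.
apply: le_trans weighted_le_layers _.
have layer_n k : (#|layer k| <= n)%N.
  by apply: leq_trans (card_layer k); rewrite leq_pmulr// expn_gt0.
have q3 : rt2 * q ^+ 3 = 1.
  apply/eqP; rewrite -(eqrXn2 (_ : (0 < 2)%N)) ?mulr_ge0 ?exprn_ge0 ?(ltW rt2_gt0)//.
  by rewrite exprMn rt2_sqr -exprM q6 divff ?expr1n.
have M0 : (0 < M)%N.
  have [a _|none] := pickP (predT : pred V).
    exact: leq_trans (mul_gt0 a) (mul_le a).
  by move: n0; rewrite -sum_mul big_pred0.
have pair_le (k l : 'I_K) : rt2 ^+ (k + l) *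
    (\sum_(a in layer k) \sum_(b in layer l) unit_pair X Y a b)%N%:R <=
    120 * L * (W * (q ^+ k * q ^+ l) + 2 * n%:R * M%:R).
  (* The layers have at most [n / 2^k] and [n / 2^l] elements, so the squared product of their sizes
     is at most [n^4 / 4^(k + l) = w^3]. As [rt2 * q^3 = 1], the weight [rt2^(k + l)] leaves
     [W q^(k + l)]. *)
  pose w := W * q ^+ (4 * (k + l)).
  have w0 : 0 <= w by rewrite mulr_ge0// exprn_ge0.
  have hw : (#|layer k| * #|layer l|)%N%:R ^+ 2 <= w ^+ 3.
    rewrite /w exprMn W3 -exprM [(_ * 3)%N](_ : _ = (6 * (2 * (k + l)))%N); last by ring.
    rewrite exprM q6 exprVn ler_pdivlMr ?exprn_gt0// -!natrX -natrM ler_nat.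
    have -> : ((#|layer k| * #|layer l|) ^ 2 * 2 ^ (2 * (k + l)) =
        (#|layer k| * 2 ^ k * (#|layer l| * 2 ^ l)) ^ 2)%N.
      by rewrite [(2 * _)%N]mulnC expnM -expnMn expnD mulnACA.
    by rewrite -[4%N]/(2 * 2)%N expnM leq_sqr -mulnn leq_mul ?card_layer.
  have I := unit_incidences XY_inj (layer_n k) (layer_n l) w0 hw.
  have rt2X j : 0 <= rt2 ^+ j by rewrite exprn_ge0// ltW.
  apply: (le_trans (ler_wpM2l (rt2X _) I)); rewrite -/L.
  have rt2_le j : rt2 ^+ j <= (2 ^ j)%N%:R.
    rewrite natrX lerXn2r ?nnegrE ?(ltW rt2_gt0)//.
    rewrite -(ler_pXn2r (_ : (0 < 2)%N)) ?nnegrE ?(ltW rt2_gt0)// rt2_sqr; lra.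
  have pow_le (j : 'I_K) : rt2 ^+ j <= M%:R.
    apply: le_trans (rt2_le j) _; rewrite ler_nat.
    apply: leq_trans (trunc_logP (isT : (1 < 2)%N) M0).
    by rewrite leq_exp2l// -ltnS.
  have card_le (j : 'I_K) : rt2 ^+ j * #|layer j|%:R <= n%:R.
    apply: (le_trans (ler_wpM2r (ler0n _ _) (rt2_le j))).
    by rewrite -natrM ler_nat mulnC card_layer.
  have wE : rt2 ^+ (k + l) * w = W * (q ^+ k * q ^+ l).
    rewrite /w mulrCA -exprD; congr (_ * _); set m := (k + l)%N.
    by rewrite [(4 * m)%N]mulSn exprD mulrCA exprM -exprMn q3 expr1n mulr1.
  (* One factor of the weight is absorbed by the size of the layer, the other is at most [M]. *)
  have kE : rt2 ^+ (k + l) * #|layer k|%:R <= n%:R * M%:R.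
    by rewrite exprD mulrAC ler_pM ?mulr_ge0.
  have lE : rt2 ^+ (k + l) * #|layer l|%:R <= n%:R * M%:R.
    by rewrite addnC exprD mulrAC ler_pM ?mulr_ge0.
  rewrite mulrCA ler_wpM2l//; last by rewrite !mulrDr wE; lra.
  by rewrite mulr_ge0.
apply: (@le_trans _ _ (2 * \sum_(k < K) \sum_(l < K)
    120 * L * (W * (q ^+ k * q ^+ l) + 2 * n%:R * M%:R))).
  by rewrite ler_pM2l//; apply: ler_sum => k _; apply: ler_sum => l _; exact: pair_le.
have -> : \sum_(k < K) \sum_(l < K) 120 * L * (W * (q ^+ k * q ^+ l) + 2 * n%:R * M%:R) =
    120 * L * (W * (\sum_(k < K) q ^+ k) ^+ 2 + 2 * K%:R ^+ 2 * n%:R * M%:R).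
  under eq_bigr do rewrite -mulr_sumr big_split /= sumr_const card_ord -mulr_sumr.
  rewrite -mulr_sumr big_split /= sumr_const card_ord -mulr_sumr.
  rewrite expr2 big_distrlr /= -mulrnA; congr (_ * (_ + _)).
  by rewrite -[LHS]mulr_natl natrM; ring.
have G0 : 0 <= \sum_(k < K) q ^+ k by apply: sumr_ge0 => k _; rewrite exprn_ge0.
have : (\sum_(k < K) q ^+ k) ^+ 2 <= (1 - q)^-1 ^+ 2.
  by rewrite lerXn2r// ?nnegrE ?invr_ge0 ?subr_ge0 ?(ltW q1)// geometric_sum_le.
move=> /(ler_wpM2l W0) WG.
rewrite (_ : 240 * L = 2 * (120 * L)); last by ring.
rewrite -[leRHS]mulrA ler_pM2l//; apply: ler_wpM2l; first by rewrite mulr_ge0.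
by rewrite lerD2r.
Qed.

End Layers.

(** * The dual plane *)

Section Logarithms.
Variable R : realType.

Lemma ln2_ge_half : 2^-1 <= ln 2 :> R.
Proof.
have := @le_ln1Dx R (- 2^-1); rewrite (_ : 1 + - 2^-1 = 2^-1); last by field.
rewrite lnV ?posrE//; lra.
Qed.

(** This lower bound lets additive constants be absorbed into powers of [ln n]. *)
Lemma ln_nat_ge_half (n : nat) : (1 < n)%N -> 2^-1 <= ln n%:R :> R.
Proof.
move=> n1; apply: (le_trans ln2_ge_half).
by rewrite ler_ln ?posrE ?ltr0n ?ler_nat// ltnW.
Qed.

Lemma ln_nat_add2 (n : nat) : (1 < n)%N -> 4 * ln (n + 2)%N%:R + 3 <= 14 * ln n%:R :> R.
Proof.
move=> n1; have := ln_nat_ge_half n1.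
suff : ln (n + 2)%N%:R <= 2 * ln n%:R :> R by lra.
rewrite mulr_natl -lnXn ?ltr0n ?(ltnW n1)// -natrX.
rewrite ler_ln ?posrE ?ltr0n ?addn2 ?expn_gt0 ?(ltnW n1)// ler_nat -mulnn.
rewrite -addn2; apply: (@leq_trans (n * 2)).
  by rewrite muln2 -addnn leq_add2l.
by rewrite leq_mul2l n1 orbT.
Qed.

Lemma trunc_log2_le (n M : nat) : (1 < n)%N -> (M <= n)%N ->
  (trunc_log 2 M).+1%:R <= 4 * ln n%:R :> R.
Proof.
move=> n1 Mn; have l1 := ln_nat_ge_half n1.
suff : (trunc_log 2 M)%:R <= 2 * ln n%:R :> R by rewrite -natr1; lra.
have tn : (2 ^ trunc_log 2 M <= n)%N.
  case: M Mn => [_|M Mn]; first by rewrite trunc_log0 ltnW.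
  by apply: leq_trans Mn; apply: trunc_logP.
have : ln (2 ^+ trunc_log 2 M) <= ln n%:R :> R.
  by rewrite ler_ln ?posrE ?exprn_gt0 ?ltr0n ?(ltnW n1)// -natrX ler_nat.
rewrite lnXn// -[ln 2 *+ _]mulr_natl; have := ln2_ge_half.
have : 0 <= (trunc_log 2 M)%:R :> R by [].
nra.
Qed.

(** The ratio gained per layer: the weight [2^(k/2)] against the saving [2^(- 2k/3)] leaves
    [2^(- k/6)]. *)
Lemma sixth_root_half : exists2 q : R, 0 <= q < 1 & q ^+ 6 = 2^-1.
Proof.
exists (2^-1 `^ 6%:R^-1); last first.
  by rewrite -powR_mulrn ?powR_ge0// -powRrM mulVf ?pnatr_eq0// powRr1.
set q := _ `^ _.
have q6 : q ^+ 6 = 2^-1.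
  by rewrite -powR_mulrn ?powR_ge0// -powRrM mulVf ?pnatr_eq0// powRr1.
rewrite powR_ge0 ltNge; apply/negP => q1.
have : 1 <= q ^+ 6 by rewrite exprn_ege1.
rewrite q6; lra.
Qed.

Lemma powR_4_3 (n : nat) : (n%:R `^ (4 / 3) : R) ^+ 3 = n%:R ^+ 4.
Proof.
rewrite -powR_mulrn ?powR_ge0// -powRrM (_ : 4 / 3 * 3%:R = 4%:R); last by field.
by rewrite powR_mulrn.
Qed.

End Logarithms.

Local Open Scope fset_scope.
Local Open Scope ring_scope.

Section DualPlaneBound.
Variables (R : realType) (P : {fset dual_plane R}).

Let U : finType := P.
Let A : {fset R * R} := [fset real_part p | p in P].
Let V : finType := A.

Let re_in (p : U) : real_part (val p) \in A.
Proof. by apply: in_imfset; exact: valP. Qed.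

Let re (p : U) : V := [` re_in p].
Let X (a : V) : R := (val a).1.
Let Y (a : V) : R := (val a).2.
Let ix (p : U) : R := dual_im (val p).1.
Let iy (p : U) : R := dual_im (val p).2.

Let XY_inj a b : X a = X b -> Y a = Y b -> a = b.
Proof.
rewrite /X /Y => ex ey; apply: val_inj; move: ex ey.
by case: (val a) => x y; case: (val b) => x' y' /= -> ->.
Qed.

Let im_inj p q : re p = re q -> ix p = ix q -> iy p = iy q -> p = q.
Proof.
case: p q => -[[x y] [z w]] pP [[[x' y'] [z' w']] qP] /(congr1 val) /= [ex ez].
by rewrite /ix /iy /= => ey ew; apply: val_inj; rewrite /= ex ez ey ew.
Qed.

Let re_surj a : exists p, re p = a.
Proof.
have /imfsetP[p /= pP ep] := valP a; exists [` pP].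
by apply: val_inj; rewrite /= ep.
Qed.

Lemma rho_eq1 (p q : U) : rho (val p) (val q) == 1 -> dual_unit_pair re X Y ix iy p q.
Proof.
rewrite /dual_unit_pair /unit_pair /X /Y /ix /iy /=.
case: p q => -[[x y] [z w]] pP [[[x' y'] [z' w']] qP] /=.
rewrite rhoE /= => /eqP[-> e]; rewrite eqxx /=; apply/eqP; lra.
Qed.

Lemma unit_distances_le_sum :
  (unit_distances P <= \sum_(p : U) \sum_(q : U) dual_unit_pair re X Y ix iy p q)%N.
Proof.
pose Z := [set pq : U * U | dual_unit_pair re X Y ix iy pq.1 pq.2].
have -> : (\sum_(p : U) \sum_(q : U) dual_unit_pair re X Y ix iy p q = #|Z|)%N.
  rewrite pair_bigA /= -sum1_card [RHS]big_mkcond; apply: eq_bigr => pq _.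
  by rewrite inE; case: dual_unit_pair.
rewrite cardE.
rewrite -(size_map (fun pq : U * U => (val pq.1, val pq.2))).
apply: uniq_leq_size; first exact: fset_uniq.
move=> [p q]; rewrite !inE /= => /andP[/andP[pP qP] /= pq1].
apply/mapP; exists ([` pP], [` qP]) => //=.
by rewrite mem_enum inE /=; exact: rho_eq1.
Qed.

Lemma fiber_le_multiplicity a : (#|[set p | re p == a]| <= multiplicity P)%N.
Proof.
pose Q := [fset p in P | real_part p == val a].
apply: (@leq_trans #|` Q|).
  rewrite cardE -(size_map val).
  apply: uniq_leq_size; first by rewrite map_inj_uniq ?enum_uniq//; exact: val_inj.
  move=> p /mapP[q]; rewrite mem_enum inE => /eqP qa ->.
  by rewrite !inE -qa /= eqxx andbT; exact: valP.
apply: (leq_bigmax_seq Q).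
  by rewrite fpowersetE; apply/fsubsetP => p; rewrite !inE => /andP[].
apply/forallP => p; apply/forallP => q.
by have := valP p; have := valP q; rewrite !inE /= => /andP[_ /eqP->] /andP[_ /eqP->].
Qed.

Lemma unit_distances_le (q : R) : 0 <= q < 1 -> q ^+ 6 = 2^-1 -> (1 < #|` P|)%N ->
  (multiplicity P <= #|` P|)%N ->
  (unit_distances P)%:R <=
    240 * 196 * ((1 - q)^-1 ^+ 2 + 33) *
    (#|` P|%:R * (multiplicity P)%:R * ln #|` P|%:R ^+ 4 +
     #|` P|%:R `^ (4 / 3) * ln #|` P|%:R ^+ 2).
Proof.
move=> q01 q6 n1 Mn.
set n := #|` P| in n1 Mn *; set M := multiplicity P in Mn *.
have nE : #|U| = n by rewrite /n cardfE.
have fiber_gt0 a : (0 < #|[set p | re p == a]|)%N.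
  by have [p <-] := re_surj a; apply/card_gt0P; exists p; rewrite inE.
apply: (@le_trans _ _ (\sum_(p : U) \sum_(q : U) dual_unit_pair re X Y ix iy p q)%N%:R).
  by rewrite ler_nat unit_distances_le_sum.
apply: le_trans (dual_unit_pairs_le XY_inj im_inj re_surj fiber_le_multiplicity) _.
have n0 : (0 < n)%N by apply: ltnW.
have sumE : (\sum_a #|[set p | re p == a]| = n)%N by rewrite sum_card_fibers.
have := weighted_incidences XY_inj fiber_gt0 fiber_le_multiplicity sumE q01 q6 n0
  (powR_ge0 _ _) (powR_4_3 R n).
rewrite nE -/M; set S := \sum_a _; set W := n%:R `^ _; set G := (1 - q)^-1 ^+ 2.
set L := 4 * ln (n + 2)%N%:R + 3; set K := (trunc_log 2 M).+1%:R.
have := ln_nat_add2 R n1; have := trunc_log2_le R n1 Mn; have := ln_nat_ge_half R n1.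
rewrite -/L -/K; set l := ln n%:R => l1 Kl Ll.
have W0 : 0 <= W by exact: powR_ge0.
have G0 : 0 <= G by rewrite sqr_ge0.
have K0 : 0 <= K by [].
have L0 : 0 <= L by rewrite addr_ge0// mulr_ge0// ln_ge0// ler1n addn2.
set m : R := M%:R; set N : R := n%:R.
have Nm0 : 0 <= N * m by rewrite mulr_ge0.
have L2 : L ^+ 2 <= 196 * l ^+ 2.
  have -> : 196 * l ^+ 2 = (14 * l) ^+ 2 by ring.
  by rewrite lerXn2r ?nnegrE// (le_trans L0).
have K2 : K ^+ 2 <= 16 * l ^+ 2.
  have -> : 16 * l ^+ 2 = (4 * l) ^+ 2 by ring.
  by rewrite lerXn2r ?nnegrE// (le_trans K0).
have l2 : 1 <= 4 * l ^+ 2 by nra.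
have l4 : 1 <= 16 * l ^+ 4.
  have -> : 16 * l ^+ 4 = (4 * l ^+ 2) ^+ 2 by ring.
  by rewrite exprn_ege1.
(* The constants come from [L <= 14 l] and [K <= 4 l]. The term [2 m N] is charged to [16 l^4 >= 1],
   and it is this extra 32 that raises [2 * 16] to 33 in the final constant. *)
move=> hS; apply: (@le_trans _ _ (240 * (196 * l ^+ 2) *
    (W * G + 2 * (16 * l ^+ 2) * N * m) + 2 * m * N * (16 * l ^+ 4))).
  apply: lerD; last by rewrite ler_peMr//; nra.
  apply: (le_trans hS); apply: ler_pM; rewrite ?mulr_ge0 ?sqr_ge0//.
  - by rewrite addr_ge0 ?(mulr_ge0 W0)// !mulr_ge0 ?sqr_ge0.
  - by rewrite ler_pM2l.
  - by rewrite lerD2l !ler_wpM2r// ler_pM2l.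
have e1 : 0 <= W * l ^+ 2 by rewrite mulr_ge0 ?sqr_ge0.
have l0 : 0 <= l by lra.
have e3 : 0 <= N * m * l ^+ 4 by rewrite mulr_ge0// exprn_ge0.
have e2 : 0 <= N * m * l ^+ 4 * G by rewrite mulr_ge0.
have -> : 240 * (196 * l ^+ 2) * (W * G + 2 * (16 * l ^+ 2) * N * m) +
    2 * m * N * (16 * l ^+ 4) =
  240 * 196 * (W * l ^+ 2 * G) + (240 * 196 + 1) * 32 * (N * m * l ^+ 4) by ring.
have -> : 240 * 196 * (G + 33) * (N * m * l ^+ 4 + W * l ^+ 2) =
  240 * 196 * (W * l ^+ 2 * G) + 240 * 196 * 33 * (W * l ^+ 2) +
  240 * 196 * (N * m * l ^+ 4 * G) + 240 * 196 * 33 * (N * m * l ^+ 4) by ring.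
lra.
Qed.

End DualPlaneBound.

Unset Implicit Arguments.

Theorem theorem1p1 (R : realType) :
  exists C : R, forall (n : nat) (lambda : R) (P : {fset dual_plane R}),
    P != fset0 ->
    #|` P| = n ->
    0 <= lambda <= 1 ->
    (multiplicity P)%:R = n%:R `^ lambda :> R ->
    (unit_distances P)%:R <=
      C * (n%:R `^ (1 + lambda) * ln n%:R ^+ 4
           + n%:R `^ (4 / 3) * ln n%:R ^+ 2).
Proof.
have [q q01 q6] := sixth_root_half R.
exists (240 * 196 * ((1 - q)^-1 ^+ 2 + 33)) => n lambda P P0 Pn /andP[l0 l1] mulE.
have n0 : (0 < n)%N by rewrite -Pn cardfs_gt0.
have n1R : 1 <= n%:R :> R by rewrite ler1n.
have n0R : 0 < n%:R :> R by rewrite ltr0n.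
(* For [n = 1] the logarithms vanish, but so does the count: the only pair has distance 0. *)
have [n1|] := ltnP 1 n; last first.
  move=> n1; have /cardfs1P[x Px] : #|` P| == 1%N by rewrite Pn eqn_leq n1.
  rewrite (_ : unit_distances P = 0%N); last first.
    apply/eqP; rewrite cardfs_eq0; apply/fset0Pn => -[[p p']].
    rewrite Px !inE /= => /andP[/andP[/eqP-> /eqP->]].
    by rewrite /rho !subrr expr0n /= addr0 eq_sym oner_eq0.
  have G0 : 0 <= (1 - q)^-1 ^+ 2 + 33 by rewrite addr_ge0 ?sqr_ge0.
  have l0' : 0 <= ln n%:R :> R by rewrite ln_ge0.
  by rewrite mulr_ge0 ?(mulr_ge0 _ G0)// addr_ge0// mulr_ge0 ?powR_ge0 ?exprn_ge0.
(* This is [n^lambda <= n], from [lambda <= 1]. *)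
have Mn : (multiplicity P <= #|` P|)%N.
  by rewrite -(ler_nat R) mulE Pn -[leRHS](powRr1 (ltW n0R)) ler_powR.
have := unit_distances_le q01 q6 _ Mn; rewrite Pn => /(_ n1).
rewrite mulE powRD ?(powRr1 (ltW n0R))//.
by rewrite (gt_eqF n0R) /= implybT.
Qed.
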